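(* Fix $T>0$ and integers $m,d\ge1$, and let $E_{m,d}$, $\mathcal F^0_t$, $I^n$ and $\mathcal D_t$ be as in the context. For every $t\in[0,T]$ the following statements hold. (i) The map $I^n:E_{m,d}\to C([0,T];\mathbb R^m)$ is Borel for every $n\ge1$. (ii) The set $\mathcal D_t$ belongs to $\mathcal F_t^0$ and is Borel. Explicitly, $$\mathcal D_t=\bigcap_{\ell\ge1}\bigcup_{N\ge1}\bigcap_{n,r\ge N}\bigl\{\|r_tI^n-r_tI^r\|_\infty<\ell^{-1}\bigr\}.$$ (iii) The partial limit $\mathcal I_t(h,x):=\lim_{n\to\infty}r_tI^n(h,x)$, $(h,x)\in\mathcal D_t$, is a Borel map from $\mathcal D_t$ to $C([0,t];\mathbb R^m)$. (iv) If $0\le s\le t\le T$, then $\mathcal D_t\subset\mathcal D_s$ and $r_s\mathcal I_t=\mathcal I_s$ on $\mathcal D_t$. (v) The system is causal: if two pairs $(h,x)$ and $(\widetilde h,\widetilde x)$ in $E_{m,d}$ agree on $[0,t]$, then either both belong to $\mathcal D_t$ or neither does; in the former case their $\mathcal I_t$-values agree.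
   Context: $E_{m,d}=D([0,T];\mathbb R^{m\times d})\times C([0,T];\mathbb R^d)$, where the first factor (càdlàg paths) carries the Skorokhod $J_1$-topology and the second the uniform topology; a generic point is $(h,x)$. The raw canonical filtration is $\mathcal F_t^0=\sigma\{h(s),x(s):0\le s\le t\}$. Matrix norms are Euclidean. $r_t$ denotes restriction of a path to $[0,t]$. For $n\ge1$ the endogenous crossing times are $\tau_0^n(h)=0$ and $$\tau_{k+1}^n(h)=\inf\{t>\tau_k^n(h):\|h(t)-h(\tau_k^n(h))\|>2^{-n}\}\wedge T,$$ with $\tau_j^n(h)=T$ for all later $j$ once the value $T$ is reached (only finitely many are $<T$). The elementary sums are the (pathwise finite) sums $$I_t^n(h,x)=\sum_{k\ge0}h(\tau_k^n(h))\bigl(x(t\wedge\tau_{k+1}^n(h))-x(t\wedge\tau_k^n(h))\bigr),\qquad 0\le t\le T.$$ $\mathcal D_t$ is the set of $(h,x)\in E_{m,d}$ for which $(r_tI^n(h,x))_{n\ge1}$ converges uniformly on $[0,t]$. *)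

(* Defs.v *)
From HB Require Import structures.
From mathcomp Require Import all_boot all_order all_algebra ring.
From mathcomp Require Import all_classical all_reals all_analysis.
Set Implicit Arguments.
Unset Strict Implicit.
Unset Printing Implicit Defensive.
Import Order.TTheory GRing.Theory Num.Theory.
Import numFieldNormedType.Exports.
Local Open Scope classical_set_scope.
Local Open Scope ring_scope.

Section EuclideanNorm.
Context {R : realType}.

(* The norm that the library puts on matrices is the maximum norm. *)
Definition enorm {p q : nat} (A : 'M[R]_(p, q)) : R :=
  Num.sqrt (\sum_i \sum_j A i j ^+ 2).

Lemma enormE p q (A : 'M[R]_(p, q)) :
  enorm A = Num.sqrt (\sum_(k : 'I_p * 'I_q) A k.1 k.2 ^+ 2).
Proof. by rewrite /enorm pair_big. Qed.

Lemma enorm_ge0 p q (A : 'M[R]_(p, q)) : 0 <= enorm A.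
Proof. exact: sqrtr_ge0. Qed.

Lemma enorm0 p q : enorm (0 : 'M[R]_(p, q)) = 0.
Proof. by rewrite enormE big1 ?sqrtr0// => k _; rewrite mxE expr0n. Qed.

Lemma enormN p q (A : 'M[R]_(p, q)) : enorm (- A) = enorm A.
Proof. by rewrite !enormE; under eq_bigr do rewrite mxE sqrrN. Qed.

Lemma sum_mul_sqr_le (I : finType) (a b : I -> R) :
  (\sum_i a i * b i) ^+ 2 <= (\sum_i a i ^+ 2) * (\sum_i b i ^+ 2).
Proof.
set A := \sum_i a i ^+ 2; set B := \sum_i b i ^+ 2; set C := \sum_i _.
have B0 : 0 <= B by apply: sumr_ge0 => i _; exact: sqr_ge0.
have : 0 <= \sum_i (B * a i - C * b i) ^+ 2.
  by apply: sumr_ge0 => i _; exact: sqr_ge0.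
have -> : \sum_i (B * a i - C * b i) ^+ 2 = B * (A * B - C ^+ 2).
  have E (x y : R) : \sum_i (x * a i - y * b i) ^+ 2 =
      x ^+ 2 * A - x * y *+ 2 * C + y ^+ 2 * B.
    rewrite /A /B /C !mulr_sumr -sumrB -big_split/=.
    by apply: eq_bigr => i _; ring.
  by rewrite E; ring.
move: B0; rewrite le_eqVlt => /predU1P[B0 _|B0].
  suff -> : C = 0 by rewrite expr0n -B0 mulr0.
  apply: big1 => i _; suff /eqP : b i ^+ 2 = 0.
    by rewrite sqrf_eq0 => /eqP ->; rewrite mulr0.
  exact: (psumr_eq0P (fun i _ => sqr_ge0 (b i)) (esym B0)).
by rewrite pmulr_rge0// subr_ge0.
Qed.

Lemma ler_enormD p q (A B : 'M[R]_(p, q)) : enorm (A + B) <= enorm A + enorm B.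
Proof.
rewrite -(ler_pXn2r (n := 2))// ?nnegrE ?addr_ge0 ?enorm_ge0//.
rewrite !enormE sqrrD !sqr_sqrtr; do ?by apply: sumr_ge0 => k _; exact: sqr_ge0.
under eq_bigr do rewrite mxE sqrrD.
rewrite !big_split/= lerD2r lerD2l -mulr2n lerMn2r/=.
rewrite -sqrtrM; last by apply: sumr_ge0 => k _; exact: sqr_ge0.
rewrite (le_trans (ler_norm _))// -sqrtr_sqr ler_wsqrtr//.
exact: sum_mul_sqr_le.
Qed.

Lemma enorm_le_sum p q (A : 'M[R]_(p, q)) :
  enorm A <= \sum_(k : 'I_p * 'I_q) `|A k.1 k.2|.
Proof.
have S0 : 0 <= \sum_(k : 'I_p * 'I_q) `|A k.1 k.2| by apply: sumr_ge0.
rewrite -(ler_pXn2r (n := 2))// ?nnegrE ?enorm_ge0//.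
rewrite enormE sqr_sqrtr; last by apply: sumr_ge0 => k _; exact: sqr_ge0.
rewrite [leRHS]expr2 mulr_suml; apply: ler_sum => k _.
rewrite -real_normK ?num_real// expr2 ler_wpM2l// (bigD1 k)//= lerDl.
exact: sumr_ge0.
Qed.

Lemma enorm_le_mx_norm p q (A : 'M[R]_(p, q)) : enorm A <= (p * q)%:R * `|A|.
Proof.
apply: (le_trans (enorm_le_sum A)).
have -> : (p * q)%:R * `|A| = \sum_(k : 'I_p * 'I_q) `|A|.
  by rewrite sumr_const card_prod !card_ord mulr_natl.
by apply: ler_sum => k _; rewrite [leRHS]mx_normrE (le_bigmax _ _ k).
Qed.

(* Convergence for the library topology, in terms of the Euclidean norm *)
Lemma cvg_enorm (X : Type) (F : set_system X) {FF : Filter F} p q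
    (f : X -> 'M[R]_(p, q)) (L : 'M[R]_(p, q)) e : f @ F --> L -> 0 < e ->
  \forall u \near F, enorm (f u - L) < e.
Proof.
move=> fL e0; pose c : R := (p * q)%:R + 1.
have c0 : 0 < c :> R by rewrite ltr_wpDl.
have ec0 : 0 < e / c by rewrite divr_gt0.
near=> u; apply: (le_lt_trans (enorm_le_mx_norm _)).
have : `|f u - L| < e / c.
  by near: u; move/cvgrPdistC_lt : fL; exact.
rewrite ltr_pdivlMr// mulrC; apply: le_lt_trans.
by rewrite ler_wpM2r// lerDl.
Unshelve. all: by end_near. Qed.

End EuclideanNorm.

Section PathSpaces.
Context {R : realType}.

(* A function on [0, t] is represented by its extension by 0 to R, so that two
   functions on [0, t] are equal iff their representatives are. *)
Record cpath (t : R) (p q : nat) := CPath {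
  cpath_fun :> R -> 'M[R]_(p, q) ;
  cpath_continuous : {within `[0, t], continuous cpath_fun} ;
  cpath_out : forall u, u \notin `[0, t] -> cpath_fun u = 0 }.

Definition cadlag (T : R) (p q : nat) (h : R -> 'M[R]_(p, q)) : Prop :=
  (forall u, 0 <= u < T -> h v @[v --> u^'+] --> h u) /\
  (forall u, 0 < u <= T -> cvg (h v @[v --> u^'-])).

Record dpath (T : R) (p q : nat) := DPath {
  dpath_fun :> R -> 'M[R]_(p, q) ;
  dpath_cadlag : cadlag T dpath_fun ;
  dpath_out : forall u, u \notin `[0, T] -> dpath_fun u = 0 }.

Lemma cpath_ext t p q (x y : cpath t p q) :
  {in `[0, t], x =1 y} -> x = y.
Proof.
move=> xy; have : x = y :> (R -> _).
  apply/funext => u; have [/xy//|ut] := boolP (u \in `[0, t]).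
  by rewrite !cpath_out.
case: x y {xy} => [x cx ox] [y cy oy] /= E; subst y.
by rewrite (Prop_irrelevance cx cy) (Prop_irrelevance ox oy).
Qed.

Lemma dpath_ext T p q (x y : dpath T p q) :
  {in `[0, T], x =1 y} -> x = y.
Proof.
move=> xy; have : x = y :> (R -> _).
  apply/funext => u; have [/xy//|ut] := boolP (u \in `[0, T]).
  by rewrite !dpath_out.
case: x y {xy} => [x cx ox] [y cy oy] /= E; subst y.
by rewrite (Prop_irrelevance cx cy) (Prop_irrelevance ox oy).
Qed.

Lemma cpath_of_subproof t p q (f : R -> 'M[R]_(p, q)) :
  {within `[0, t], continuous f} ->
  {within `[0, t], continuous (patch (fun=> 0) `[0, t] f)}.
Proof.
apply: subspace_eq_continuous => u ut.
by rewrite /from_subspace/= /patch ut.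
Qed.

Lemma patch_out t p q (f : R -> 'M[R]_(p, q)) u :
  u \notin `[0, t] -> patch (fun=> 0) `[0, t] f u = 0.
Proof. by move=> ut; rewrite /patch mem_setE (negbTE ut). Qed.

Definition cpath_of t p q (f : R -> 'M[R]_(p, q))
    (cf : {within `[0, t], continuous f}) : cpath t p q :=
  CPath (cpath_of_subproof cf) (@patch_out t p q f).

Lemma cpath_ofE t p q (f : R -> 'M[R]_(p, q))
    (cf : {within `[0, t], continuous f}) u :
  u \in `[0, t] -> cpath_of cf u = f u.
Proof. by move=> ut; rewrite /= /patch mem_setE ut. Qed.

Lemma cadlag0 T p q : cadlag T (fun=> 0 : 'M[R]_(p, q)).
Proof.
split=> u _; first exact: cvg_cst.
by apply/cvg_ex; exists 0; exact: cvg_cst.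
Qed.

Lemma continuous_within0 (t : R) p q :
  {within `[0, t], continuous (fun=> 0 : 'M[R]_(p, q))}.
Proof. by apply: continuous_subspaceT => u; exact: cvg_cst. Qed.

Definition cpath0 t p q : cpath t p q :=
  CPath (@continuous_within0 t p q) (fun _ _ => erefl).

Definition dpath0 T p q : dpath T p q :=
  DPath (@cadlag0 T p q) (fun _ _ => erefl).

HB.instance Definition _ t p q := gen_eqMixin (cpath t p q).
HB.instance Definition _ t p q := gen_choiceMixin (cpath t p q).
HB.instance Definition _ t p q := isPointed.Build (cpath t p q) (cpath0 t p q).
HB.instance Definition _ t p q := gen_eqMixin (dpath t p q).
HB.instance Definition _ t p q := gen_choiceMixin (dpath t p q).
HB.instance Definition _ t p q := isPointed.Build (dpath t p q) (dpath0 t p q).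

(* C([0, t]; R^(p x q)) carries the topology of uniform convergence. *)
HB.instance Definition _ t p q := Uniform.copy (cpath t p q)
  (initial_topology
     (@cpath_fun t p q : cpath t p q -> {uniform` `[0, t] -> 'M[R]_(p, q)})).

Lemma cpath_restr_subproof (s t : R) p q (x : cpath t p q) : s <= t ->
  {within `[0, s], continuous x}.
Proof.
move=> st; apply: continuous_subspaceW (@cpath_continuous _ _ _ x).
by apply: subset_itvl; rewrite bnd_simp.
Qed.

Definition cpath_restr (s t : R) p q (st : s <= t) (x : cpath t p q) :
  cpath s p q := cpath_of (@cpath_restr_subproof s t p q x st).

(* +oo if f is unbounded on [0, t] *)
Definition supnorm (t : R) p q (f : R -> 'M[R]_(p, q)) : \bar R :=
  ereal_sup [set (enorm (f u))%:E | u in `[0, t]].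

Definition time_change (T : R) (l : R -> R) : Prop :=
  [/\ {in `[0, T] &, {homo l : u v / u < v}},
      l @` `[0, T] = `[0, T]%classic
    & {within `[0, T], continuous l}].

Definition time_change_cost (T : R) p q (l : R -> R) (h g : R -> 'M[R]_(p, q)) :
    \bar R :=
  maxe (ereal_sup [set `|l u - u|%:E | u in `[0, T]])
       (supnorm T (fun u => h u - g (l u))).

Definition J1_dist (T : R) p q (h g : R -> 'M[R]_(p, q)) : \bar R :=
  ereal_inf [set time_change_cost T l h g | l in time_change T].

Lemma time_change_in T l u : time_change T l -> u \in `[0, T] ->
  l u \in `[0, T].
Proof.
case=> _ im _ uT; have : (l @` `[0, T]) (l u) by exists u.
by rewrite im.
Qed.

Lemma inc_image_time_change T l : {in `[0, T] &, {homo l : u v / u < v}} ->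
  l @` `[0, T] = `[0, T]%classic -> time_change T l.
Proof.
move=> inc im; split => //; have [T0|T0] := ltP T 0.
  apply/subspace_continuousP => u; rewrite /= in_itv/= => /andP[u0 uT].
  by have := le_lt_trans (le_trans u0 uT) T0; rewrite ltxx.
have mono := le_mono_in inc.
have lin u : u \in `[0, T] -> l u \in `[0, T].
  by move=> uT; have : (l @` `[0, T]) (l u) by [exists u]; rewrite im.
have in0 : 0 \in `[0, T] by rewrite in_itv/= lexx.
have inT : T \in `[0, T] by rewrite in_itv/= lexx andbT.
have l0 : l 0 = 0.
  have [x xT x0] : (l @` `[0, T]) 0 by rewrite im.
  have : l 0 <= l x by rewrite mono//; move: xT; rewrite /= in_itv => /andP[].
  rewrite x0 => l0; apply/eqP; rewrite eq_le l0/=.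
  by move: (lin _ in0); rewrite in_itv => /andP[].
have lT : l T = T.
  have [x xT x0] : (l @` `[0, T]) T by rewrite im.
  have : l x <= l T by rewrite mono//; move: xT; rewrite /= in_itv => /andP[].
  rewrite x0 => lT; apply/eqP; rewrite eq_le lT andbT.
  by move: (lin _ inT); rewrite in_itv => /andP[].
apply: segment_inc_surj_continuous => //.
by rewrite l0 lT => y yT; rewrite im.
Qed.

Lemma time_change_id T : time_change T id.
Proof. by apply: inc_image_time_change => //; rewrite image_id. Qed.

Lemma time_change_comp T l m : time_change T l -> time_change T m ->
  time_change T (m \o l).
Proof.
move=> tl tm; have [incl iml _] := tl; have [incm imm _] := tm.
apply: inc_image_time_change => [u v uT vT uv/=|].
  by apply: incm; rewrite ?time_change_in//; exact: incl.
by rewrite -image_comp iml imm.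
Qed.

Lemma time_change_inv T l : time_change T l ->
  exists2 m, time_change T m & {in `[0, T], cancel m l}.
Proof.
move=> tl; have [inc im _] := tl.
have mono := le_mono_in inc.
have /choice[m mP] : forall y, exists x, y \in `[0, T] -> x \in `[0, T] /\ l x = y.
  move=> y; have [yT|] := boolP (y \in `[0, T]); last by exists 0.
  have [x xT xy] : (l @` `[0, T]) y by rewrite im.
  by exists x.
have lm : {in `[0, T], cancel m l} by move=> y /mP[].
exists m => //; apply: inc_image_time_change.
  move=> u v uT vT uv; rewrite ltNge -mono ?lm -?ltNge//.
  - by have [] := mP _ vT.
  - by have [] := mP _ uT.
apply/seteqP; split=> [_ [u uT <-]|u uT]; first by have [] := mP _ uT.
exists (l u); first exact: time_change_in.
have luT := time_change_in tl uT; have [mT lml] := mP _ luT.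
by apply: (inc_inj_in mono).
Qed.

Lemma J1_distP T p q (h g : R -> 'M[R]_(p, q)) (e : R) :
  (J1_dist T h g < e%:E)%E <->
  exists2 l, time_change T l & (time_change_cost T l h g < e%:E)%E.
Proof.
split=> [/ereal_inf_ltP[_ [l tl <-] le]|[l tl le]]; first by exists l.
by apply/ereal_inf_ltP; exists (time_change_cost T l h g) => //; exists l.
Qed.

Definition J1_ball (T : R) p q (h : dpath T p q) (e : R) (g : dpath T p q) :
  Prop := (J1_dist T h g < e%:E)%E.

Lemma J1_ball_center T p q (h : dpath T p q) e : 0 < e -> J1_ball h e h.
Proof.
move=> e0; apply/J1_distP; exists id; first exact: time_change_id.
rewrite /time_change_cost gt_max; apply/andP; split.
  apply: (@le_lt_trans _ _ 0%E); last by rewrite lte_fin.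
  by apply: ge_ereal_sup => _ [u _ <-]; rewrite subrr normr0.
apply: (@le_lt_trans _ _ 0%E); last by rewrite lte_fin.
by apply: ge_ereal_sup => _ [u _ <-]; rewrite subrr enorm0.
Qed.

Lemma J1_ball_sym T p q (h g : dpath T p q) e : J1_ball h e g -> J1_ball g e h.
Proof.
move=> /J1_distP[l tl he]; apply/J1_distP.
have [m tm lm] := time_change_inv tl; exists m => //.
apply: le_lt_trans he; rewrite /time_change_cost ge_max !le_max.
apply/andP; split; apply/orP; [left|right].
  apply: ge_ereal_sup => _ [u uT <-]; apply: ereal_sup_ubound.
  by exists (m u); [exact: time_change_in|rewrite lm// distrC].
apply: ge_ereal_sup => _ [u uT <-]; apply: ereal_sup_ubound.
by exists (m u); [exact: time_change_in|rewrite lm// -enormN opprB].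
Qed.

Lemma J1_ball_triangle T p q (h g k : dpath T p q) e1 e2 :
  J1_ball h e1 g -> J1_ball g e2 k -> J1_ball h (e1 + e2) k.
Proof.
move=> /J1_distP[l tl le] /J1_distP[m tm me]; apply/J1_distP.
exists (m \o l); first exact: time_change_comp.
rewrite EFinD; apply: le_lt_trans (lteD le me).
rewrite /time_change_cost ge_max; apply/andP; split.
  apply: ge_ereal_sup => _ [u uT <-].
  apply: (@le_trans _ _ (`|l u - u|%:E + `|m (l u) - l u|%:E)%E).
    by rewrite -EFinD lee_fin [leRHS]addrC (le_trans _ (ler_normD _ _))// addrA subrK.
  apply: leeD; rewrite le_max; apply/orP; left; apply: ereal_sup_ubound.
    by exists u.
  by exists (l u) => //; exact: time_change_in.
apply: ge_ereal_sup => _ [u uT <-].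
apply: (@le_trans _ _
    ((enorm (h u - g (l u)))%:E + (enorm (g (l u) - k (m (l u))))%:E)%E).
  by rewrite -EFinD lee_fin (le_trans _ (ler_enormD _ _))// addrA subrK.
apply: leeD; rewrite le_max; apply/orP; right; apply: ereal_sup_ubound.
  by exists u.
by exists (l u) => //; exact: time_change_in.
Qed.

(* D([0, T]; R^(p x q)) carries the Skorokhod J1 topology, induced by the
   distance J1_dist. *)
HB.instance Definition _ T p q :=
  hasNbhs.Build (dpath T p q) (nbhs_ (entourage_ (@J1_ball T p q))).
HB.instance Definition _ T p q := @Nbhs_isPseudoMetric.Build R (dpath T p q)
  (entourage_ (@J1_ball T p q)) erefl (@J1_ball T p q)
  (@J1_ball_center T p q) (@J1_ball_sym T p q) (@J1_ball_triangle T p q) erefl.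

End PathSpaces.

Section ElementarySums.
Context {R : realType}.

Definition exceed_times (T : R) (n : nat) p q (h : R -> 'M[R]_(p, q)) (a : R) :
    set R :=
  [set u | a < u <= T /\ 2 ^- n < enorm (h u - h a)].

(* The infimum is taken in \bar R, where inf set0 = +oo, and is then capped
   at T. *)
Definition next_crossing (T : R) (n : nat) p q (h : R -> 'M[R]_(p, q)) (a : R) :
    R :=
  fine (mine (ereal_inf (EFin @` exceed_times T n h a)) T%:E).

Fixpoint crossing_time (T : R) (n : nat) p q (h : R -> 'M[R]_(p, q)) (k : nat) :
    R :=
  if k is k'.+1 then next_crossing T n h (crossing_time T n h k') else 0.

(* The sum \sum_(k \in A) is the sum over the k in A at which the term is not
   0; crossing_time_eventually below shows that there are finitely many. *)
Definition elem_sum (T : R) (n : nat) p q (h : R -> 'M[R]_(p, q))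
    (x : R -> 'cV[R]_q) (u : R) : 'cV[R]_p :=
  \sum_(k \in [set: nat])
    h (crossing_time T n h k) *m
      (x (Num.min u (crossing_time T n h k.+1)) -
       x (Num.min u (crossing_time T n h k))).

Lemma next_crossingP (T : R) n p q (h : R -> 'M[R]_(p, q)) a : a <= T ->
  [/\ a <= next_crossing T n h a, next_crossing T n h a <= T &
   next_crossing T n h a < T -> forall e, 0 < e ->
     exists2 u, exceed_times T n h a u &
       next_crossing T n h a <= u < next_crossing T n h a + e].
Proof.
move=> aT; rewrite /next_crossing; set S := EFin @` _; set i := ereal_inf S.
have ai : (a%:E <= i)%E.
  by apply: le_ereal_inf_tmp => _ [u [/andP[au _] _] <-]; rewrite lee_fin ltW.
have [iT|Ti] := leP i T%:E; last first.
  by split; rewrite /= ?ltxx.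
have ifin : i \is a fin_num.
  by rewrite fin_numE; apply/andP; split; apply/eqP => E; move: ai iT; rewrite E.
have iE := fineK ifin.
split; rewrite -?lee_fin ?iE// => _ e e0.
have [_ [u Su <-] ui] := lb_ereal_inf_adherent e0 ifin.
exists u => //; rewrite -lee_fin -lte_fin EFinD iE ui andbT.
by apply: ereal_inf_lbound; exists u.
Qed.

Lemma cadlag_right (T : R) p q (h : R -> 'M[R]_(p, q)) a e : cadlag T h ->
  0 <= a < T -> 0 < e ->
  exists2 d, 0 < d & forall u, a <= u < a + d -> enorm (h u - h a) < e.
Proof.
move=> [ch _] /ch ha e0; have [d /= d0 dP] := (nbhs_ballP _ _).1 (cvg_enorm ha e0).
exists d => // u /andP[]; rewrite le_eqVlt => /predU1P[<- _|au ud].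
  by rewrite subrr enorm0.
apply: dP => //; rewrite /ball/= distrC gtr0_norm ?subr_gt0//.
by rewrite ltrBlDl.
Qed.

Lemma cadlag_left (T : R) p q (h : R -> 'M[R]_(p, q)) a e : cadlag T h ->
  0 < a <= T -> 0 < e ->
  exists2 d, 0 < d & forall u v, a - d < u < a -> a - d < v < a ->
    enorm (h u - h v) < e.
Proof.
move=> [_ ch] /ch /cvg_ex[L hL] e0.
have e20 : 0 < e / 2 by rewrite divr_gt0.
have [d /= d0 dP] := (nbhs_ballP _ _).1 (cvg_enorm hL e20).
have P u : a - d < u < a -> enorm (h u - L) < e / 2.
  move=> /andP[adu ua]; apply: dP => //.
  by rewrite /ball/= gtr0_norm ?subr_gt0// ltrBlDr addrC -ltrBlDr.
exists d => // u v /P uL /P vL; rewrite [e]splitr.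
apply: le_lt_trans (ltrD uL vL).
by rewrite -(enormN (h v - L)) opprB (le_trans _ (ler_enormD _ _))// addrA subrK.
Qed.

Lemma cvg_mx (X : Type) (F : set_system X) {FF : Filter F} p q
    (f : X -> 'M[R]_(p, q)) (L : 'M[R]_(p, q)) :
  (forall i j, f x i j @[x --> F] --> L i j) -> f @ F --> L.
Proof.
move=> fL A [P LP PA]; apply: (filterS PA).
by do 2 apply: filter_forall => ?; exact/fL/LP.
Qed.

Lemma cvg_mulmxl (X : Type) (F : set_system X) {FF : Filter F}
    p q r (M : 'M[R]_(p, q)) (f : X -> 'M[R]_(q, r)) (L : 'M[R]_(q, r)) :
  f @ F --> L -> (M *m f x) @[x --> F] --> M *m L.
Proof.
move=> fL; apply: cvg_mx => i j; rewrite mxE; under eq_fun do rewrite mxE.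
apply: cvg_big => [|k _]; first exact: add_continuous.
apply: cvgM; first exact: cvg_cst.
apply: (@cvg_comp _ _ _ f (fun N : 'M[R]_(q, r) => N k j) _ _ _ fL).
exact: coord_continuous.
Qed.
Lemma cvg_min_within (T c u : R) : 0 <= c -> 0 <= u ->
  (Num.min v c) @[v --> within `[0, T] (nbhs u)] --> within `[0, T] (nbhs (Num.min u c)).
Proof.
move=> c0 u0.
have C : {for u, continuous (fun v => Num.min v c)}.
   by apply: continuous_min; [exact: cvg_id|exact: cvg_cst].
move=> A /= /C NA; apply: (filterS (P := fun v => `[0, T]%classic (Num.min v c) -> A (Num.min v c))) NA => v /= vA; rewrite in_itv/= => /andP[v0 vT].
by apply: vA; rewrite /= in_itv/= le_min v0 c0 ge_min vT.
Qed.

Section Cadlag.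
Variables (T : R) (n p q : nat) (h : R -> 'M[R]_(p, q)).
Hypotheses (T0 : 0 <= T) (ch : cadlag T h).
Local Notation tau := (crossing_time T n h).

Lemma crossing_time_itv k : 0 <= tau k <= T.
Proof.
elim: k => [|k /andP[k0 kT]]; first by rewrite lexx.
by have [/(le_trans k0) -> ->] := next_crossingP n h kT.
Qed.

Lemma crossing_time_le k : tau k <= tau k.+1.
Proof.
by have /andP[_ /(next_crossingP n h)[]] := crossing_time_itv k.
Qed.

Lemma crossing_time_homo k l : (k <= l)%N -> tau k <= tau l.
Proof. by apply: (@homo_leq _ tau <=%R) => //; [exact: le_trans|exact: crossing_time_le]. Qed.

Lemma crossing_time_lt k : tau k < T -> tau k < tau k.+1.
Proof.
move=> kT; rewrite lt_neqAle crossing_time_le andbT; apply/eqP => E.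
have /andP[k0 _] := crossing_time_itv k.
have e0 : 0 < 2 ^- n :> R by rewrite invr_gt0 exprn_gt0.
have k0T : 0 <= tau k < T by rewrite k0.
have [d d0 dP] := cadlag_right ch k0T e0.
have [_ _] := next_crossingP n h (ltW kT).
rewrite -/(tau k.+1) -E => /(_ kT d d0)[u [_ ue] /dP ud].
by have := lt_trans ue ud; rewrite ltxx.
Qed.

Lemma crossing_time_jump k : tau k.+1 < T ->
  2 ^- n <= enorm (h (tau k.+1) - h (tau k)).
Proof.
move=> kT; have kT' := le_lt_trans (crossing_time_le k) kT.
rewrite leNgt; apply/negP => ke.
have k0T : 0 <= tau k.+1 < T.
  by rewrite kT andbT; have /andP[] := crossing_time_itv k.+1.
have e0 : 0 < 2 ^- n - enorm (h (tau k.+1) - h (tau k)) by rewrite subr_gt0.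
have [d d0 dP] := cadlag_right ch k0T e0.
have [_ _ /(_ kT d d0)[u [_ ue] /dP ud]] := next_crossingP n h (ltW kT').
have := lt_le_trans ue _; rewrite -[h u](subrK (h (tau k.+1))) -addrA.
move=> /(_ _ (ler_enormD _ _)); rewrite -ltrBlDr => /lt_trans/(_ ud).
by rewrite ltxx.
Qed.

Lemma crossing_time_reaches : exists k, tau k = T.
Proof.
apply/not_existsP => NT.
have ltT k : tau k < T.
  rewrite lt_neqAle; apply/andP; split; first exact/eqP/NT.
  by have /andP[] := crossing_time_itv k.
have hs : has_sup (range tau).
  split; first by exists (tau 0%N); exists 0%N.
  by exists T => _ [k _ <-]; exact: ltW.
pose s := sup (range tau).
have les k : tau k <= s by apply: (ub_le_sup hs.2); exists k.
have lts k : tau k < s := lt_le_trans (crossing_time_lt (ltT k)) (les k.+1).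
have s0T : 0 < s <= T.
  apply/andP; split; first exact: (lts 0%N).
  by apply: ge_sup hs.1 _ => _ [k _ <-]; exact: ltW.
have e0 : 0 < 2 ^- n :> R by rewrite invr_gt0 exprn_gt0.
have [d d0 dP] := cadlag_left ch s0T e0.
have [_ [k _ <-] dk] := sup_adherent d0 hs.
have := crossing_time_jump (ltT k.+1); rewrite leNgt => /negP; apply.
by apply: dP; rewrite lts andbT// (lt_le_trans dk)// crossing_time_le.
Qed.

Lemma crossing_time_eventually : exists K, forall k, (K <= k)%N -> tau k = T.
Proof.
have [K KT] := crossing_time_reaches; exists K => k /crossing_time_homo.
rewrite KT => Tk; apply/eqP; rewrite eq_le Tk andbT.
by have /andP[] := crossing_time_itv k.
Qed.

Lemma elem_sum_ord : exists K, forall (x : R -> 'cV[R]_q) u, u <= T ->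
  elem_sum T n h x u = \sum_(k < K)
    h (tau k) *m (x (Num.min u (tau k.+1)) - x (Num.min u (tau k))).
Proof.
have [K KP] := crossing_time_eventually; exists K => x u uT.
rewrite /elem_sum (fsbig_ord _ _ (fun k =>
  h (tau k) *m (x (Num.min u (tau k.+1)) - x (Num.min u (tau k))))).
apply/esym/fsbig_widen => // k [_ kK].
have Kk : (K <= k)%N by rewrite leqNgt; apply/negP.
by rewrite /preimage/= -[next_crossing _ _ _ _]/(tau k.+1) !KP ?(leqW Kk)// subrr mulmx0.
Qed.

Lemma elem_sum_continuous (x : cpath T q 1) :
  {within `[0, T], continuous (elem_sum T n h x)}.
Proof.
have [K KP] := elem_sum_ord.
apply: (@subspace_eq_continuous _ _ _ (fun u => \sum_(k < K)
    h (tau k) *m (x (Num.min u (tau k.+1)) - x (Num.min u (tau k))))).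
  by move=> u; rewrite inE/= in_itv/= => /andP[_ uT]; rewrite /from_subspace KP.
have /subspace_continuousP cx := @cpath_continuous _ _ _ _ x.
have cmin c : 0 <= c <= T -> forall u, u \in `[0, T] ->
    x (Num.min v c) @[v --> within `[0, T] (nbhs u)] --> x (Num.min u c).
  move=> /andP[c0 cT] u; rewrite in_itv/= => /andP[u0 uT].
  apply: (@cvg_comp _ _ _ (fun v => Num.min v c) x _ _ _
    (@cvg_min_within T c u c0 u0)).
  apply: cx.
  by rewrite /= in_itv/= le_min u0 c0 ge_min uT.
apply/subspace_continuousP => u /= uT.
apply: cvg_big => [|k _]; first exact: add_continuous.
apply: cvg_mulmxl; apply: cvgB; apply: cmin => //.
  exact: (crossing_time_itv k.+1).
exact: crossing_time_itv.
Qed.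

End Cadlag.

Lemma elem_integral_subproof (T : R) n p q (h : dpath T p q) (x : cpath T q 1) :
  {within `[0, T], continuous (elem_sum T n h x)}.
Proof.
have [T0|T0] := leP 0 T.
  by apply: elem_sum_continuous => //; exact: dpath_cadlag.
apply/subspace_continuousP => u; rewrite /= in_itv/= => /andP[u0 uT].
by have := le_lt_trans (le_trans u0 uT) T0; rewrite ltxx.
Qed.

End ElementarySums.

Notation borelType X := (g_sigma_algebraType (@open X)).

Section CausalSystem.
Context {R : realType}.

Definition path_space (T : R) (m d : nat) : Type :=
  (dpath T m d * cpath T d 1)%type.

Definition raw_filtration (T : R) (m d : nat) (t : R) :
    set (set (path_space T m d)) :=
  <<s \bigcup_(s in `[0, t])
        (preimage_set_system setT (fun z : path_space T m d => z.1 s)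
           (<<s open >>) `|`
         preimage_set_system setT (fun z : path_space T m d => z.2 s)
           (<<s open >>)) >>.

Definition elem_integral (T : R) (m d n : nat) (z : path_space T m d) :
  cpath T m 1 := cpath_of (@elem_integral_subproof R T n m d z.1 z.2).

(* Convergence in cpath t m 1, that is, uniform convergence on [0, t] *)
Definition conv_dom (T : R) (m d : nat) (t : R) (tT : t <= T) :
    set (path_space T m d) :=
  [set z | cvg (cpath_restr tT (elem_integral n z) @[n --> \oo])].

(* Only meaningful on conv_dom tT *)
Definition limit_integral (T : R) (m d : nat) (t : R) (tT : t <= T)
    (z : path_space T m d) : cpath t m 1 :=
  lim (cpath_restr tT (elem_integral n z) @[n --> \oo]).

End CausalSystem.

Arguments conv_dom {R T} m d {t} tT _.

(* Main.v *)
Require Import Defs.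
From HB Require Import structures.
From mathcomp Require Import all_boot all_order all_algebra.
From mathcomp Require Import all_classical all_reals all_analysis.
From mathcomp Require Import measurable_realfun measurable_fun_approximation.
Set Implicit Arguments.
Unset Strict Implicit.
Unset Printing Implicit Defensive.
Import Order.TTheory GRing.Theory Num.Theory.
Import numFieldNormedType.Exports.
Local Open Scope classical_set_scope.
Local Open Scope ring_scope.

(** The value [I^n_u] of an elementary sum at a time [u] depends measurably on
    the values of the two paths at the times [s <= u]. Indeed the crossing
    times stopped at [u] are measurable for these values, by induction: a
    crossing is a strict inequality, so by right-continuity it takes place
    before [c] iff it is witnessed at a rational time before [c]
    ([next_crossing_ltP]), and a right-continuous process is measurable at a
    measurable random time ([measurable_at_random_time]). Stopping all the
    crossing times at [u] does not change the sum ([elem_sum_stopped]), whence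
    [measurable_fun_elem_sum]. The argument is carried out over an arbitrary
    measurable space on which the evaluations of the two paths are measurable,
    and it is then applied twice: to the raw filtration, where this holds by
    definition, and to the Borel sigma-algebra of the path space, where it
    requires evaluation at a time to be Borel for the Skorokhod topology. The
    latter holds because exceeding a level somewhere in an open time interval
    is an open condition on the path ([open_dpath_exceeds]), and by
    right-continuity such conditions determine the value at the left end of
    the interval ([dpath_ge_exceeds]); the final time is fixed by all time
    changes.

    A map into the continuous paths with measurable evaluations is Borel
    ([measurable_fun_cpath]): the uniform neighbourhoods of step functions with
    rational values form a countable network of that space, and belonging to
    one of them is tested at rational times. This gives (i), and (iii) since
    evaluations of the limit are pointwise limits. As the space of continuous
    paths is complete, the domain of convergence consists of the pairs with
    uniformly Cauchy sums ([cvg_cpath_cauchyP]), and the Cauchy condition may be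
    tested at rational times ([conv_dom_rtimeP]); this gives (ii), and the
    restriction property (iv). Causality (v) is a consequence of measurability:
    an event of the raw filtration at time [t] does not separate two pairs that
    agree on [[0, t]] ([filtration_causal]). *)

(** * Norms of matrices and uniform convergence of paths *)

Section MatrixNorm.
Context {R : realType} {p q : nat}.
Implicit Types A : 'M[R]_(p, q).

Lemma coord_le_mx_norm A i j : `|A i j| <= `|A|.
Proof.
rewrite [leRHS]mx_normrE.
exact: (le_bigmax _ (fun k : 'I_p * 'I_q => `|A k.1 k.2|) (i, j)).
Qed.

Lemma mx_norm_le A (e : R) : 0 <= e -> (forall i j, `|A i j| <= e) -> `|A| <= e.
Proof.
by move=> e0 Ae; rewrite [leLHS]mx_normrE; apply: bigmax_le.
Qed.

Lemma coord_le_enorm A i j : `|A i j| <= enorm A.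
Proof.
rewrite -sqrtr_sqr enormE ler_wsqrtr// (bigD1 (i, j))//= lerDl.
by apply: sumr_ge0 => k _; exact: sqr_ge0.
Qed.

Lemma mx_norm_le_enorm A : `|A| <= enorm A.
Proof. by apply: mx_norm_le (enorm_ge0 _) _ => i j; exact: coord_le_enorm. Qed.

End MatrixNorm.

Section UniformTopology.
Context {R : realType} {t : R} {p q : nat}.
Implicit Types x y : cpath t p q.

(** The neighbourhoods of a continuous path, in terms of the uniform distance *)
Lemma nbhs_cpathP x (A : set (cpath t p q)) :
  nbhs x A <-> exists2 e : R, 0 < e &
    forall y, (forall u : R, u \in `[0, t] -> `|x u - y u| < e) -> A y.
Proof.
split.
  move=> [_ [[B oB <-] /= Bx BA]].
  have /uniform_nbhs[E [/= + EB]] :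
    nbhs (cpath_fun x : {uniform` `[0, t] -> 'M[R]_(p, q)}) B.
    exact: open_nbhs_nbhs.
  rewrite -entourage_ballE => -[e /= e0 eE].
  exists e => // y xy; apply: BA; apply: EB => u /= ut; apply: eE => /=.
  by rewrite -ball_normE/=; exact: xy.
move=> [e e0 eA].
have : nbhs (cpath_fun x : {uniform` `[0, t] -> 'M[R]_(p, q)})
    [set g | forall u : R, u \in `[0, t] -> `|x u - g u| < e].
  apply/uniform_nbhs; exists [set z | ball z.1 e z.2]; split.
    by rewrite -entourage_ballE; exists e.
  by move=> g /= xg u ut; have := xg u ut; rewrite -ball_normE.
rewrite nbhsE => -[B [oB Bx] BS].
exists (@cpath_fun _ _ _ _ @^-1` B); split => //; first by exists B.
by move=> y /BS/=; exact: eA.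
Qed.

Lemma cvg_cpathP (f : nat -> cpath t p q) x :
  f n @[n --> \oo] --> x <-> forall e : R, 0 < e ->
    exists N, forall n, (N <= n)%N -> forall u : R, u \in `[0, t] ->
      `|x u - f n u| < e.
Proof.
split=> [fx e e0|fx A /nbhs_cpathP[e /fx[N NP] eA]].
  have [|N _ NP] := fx [set y | forall u : R, u \in `[0, t] -> `|x u - y u| < e].
    by apply/nbhs_cpathP; exists e.
  by exists N => n Nn; exact: NP.
by exists N => // n /= Nn; apply: eA; exact: NP.
Qed.

(** Completeness of the space of continuous paths *)
Lemma cvg_cpath_cauchyP (f : nat -> cpath t p q) :
  cvg (f n @[n --> \oo]) <-> forall e : R, 0 < e ->
    exists N, forall n r, (N <= n)%N -> (N <= r)%N -> forall u : R, u \in `[0, t] ->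
      `|f n u - f r u| < e.
Proof.
split=> [/cvg_ex[x /cvg_cpathP fx] e e0|fc].
  have [N NP] := fx _ (divr_gt0 e0 (ltr0Sn R 1)); exists N => n r Nn Nr u ut.
  rewrite [e]splitr (le_lt_trans _ (ltrD (NP n Nn u ut) (NP r Nr u ut)))//.
  by rewrite (distrC (x u)) (le_trans _ (ler_normD _ _))// addrA subrK.
have cu (u : R) : u \in `[0, t] -> cvg (f n u @[n --> \oo]).
  move=> ut; apply/cauchy_cvgP/cauchy_exP => e e0.
  have [N NP] := fc _ e0; exists (f N u), N => // n /= Nn.
  by rewrite -ball_normE/=; exact: NP.
pose g u := lim (f n u @[n --> \oo]).
have fg e : 0 < e -> exists N, forall n, (N <= n)%N -> forall u,
    u \in `[0, t] -> `|g u - f n u| <= e.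
  move=> /fc[N NP]; exists N => n Nn u ut.
  apply/ler_addgt0Pr => c c0.
  have /cvgrPdist_lt/(_ c c0)[M _ MP] : f r u @[r --> \oo] --> g u := cu u ut.
  pose r := maxn N M.
  have := ltrD (NP r n (leq_maxl _ _) Nn u ut) (MP r (leq_maxr _ _)).
  move=> /ltW; apply: le_trans.
  by rewrite [leRHS]addrC (le_trans _ (ler_normD _ _))// addrA subrK.
have cg : {within `[0, t], continuous g}.
  apply: (@uniform_limit_continuous_subspace _ _ _
    ((fun n => cpath_fun (f n)) @ \oo)).
    by exists 0%N => // n _; exact: cpath_continuous.
  move=> A /uniform_nbhs[E [/= + EA]].
  rewrite -entourage_ballE => -[e /= e0 eE].
  have [N NP] := fg _ (divr_gt0 e0 (ltr0Sn R 1)); exists N => // n /= Nn.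
  apply: EA => u /= ut; apply: eE => /=; rewrite -ball_normE/=.
  by rewrite (le_lt_trans (NP n Nn u ut))// ltr_pdivrMr// ltr_pMr// ltr1n.
apply/cvg_ex; exists (cpath_of cg); apply/cvg_cpathP => e e0.
have [N NP] := fg _ (divr_gt0 e0 (ltr0Sn R 1)); exists N => n Nn u ut.
rewrite cpath_ofE// (le_lt_trans (NP n Nn u ut))//.
by rewrite ltr_pdivrMr// ltr_pMr// ltr1n.
Qed.

Lemma cvg_cpath_eval (f : nat -> cpath t p q) x u : u \in `[0, t] ->
  f n @[n --> \oo] --> x -> f n u @[n --> \oo] --> x u.
Proof.
move=> ut /cvg_cpathP fx; apply/cvgrPdist_lt => e e0.
by have [N NP] := fx e e0; exists N => // n /= Nn; exact: NP.
Qed.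

End UniformTopology.

(** * Measurability of countable conditions *)

Section CountableOperations.
Context {d : measure_display} {T : measurableType d} {I : countType}.
Implicit Type F : I -> set T.

Lemma measurable_exists F : (forall i, measurable (F i)) ->
  measurable [set x | exists i, F i x].
Proof.
move=> mF; rewrite (_ : mkset _ = \bigcup_i F i).
  exact: countable_bigcupT_measurable.
by apply/seteqP; split=> x /= [i]; exists i.
Qed.

Lemma measurable_forall F : (forall i, measurable (F i)) ->
  measurable [set x | forall i, F i x].
Proof.
move=> mF; rewrite (_ : mkset _ = ~` [set x | exists i, (~` F i) x]).
  by apply/measurableC/measurable_exists => i; exact: measurableC.
apply/seteqP; split=> x /=; first by move=> Fx [i]; apply.
by move=> /forallNP Fx i; exact: contrapT.
Qed.

Lemma measurable_imply (P : Prop) (A : set T) :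
  (P -> measurable A) -> measurable [set x | P -> A x].
Proof.
move=> mA; have [p|np] := pselect P.
  by rewrite (_ : mkset _ = A); [exact: mA|apply/seteqP; split=> x /=; auto].
by rewrite (_ : mkset _ = setT)//; apply/seteqP; split=> x /=.
Qed.

Lemma measurable_cond (P : Prop) (A : set T) :
  (P -> measurable A) -> measurable [set x | P /\ A x].
Proof.
move=> mA; have [p|np] := pselect P.
  by rewrite (_ : mkset _ = A); [exact: mA|apply/seteqP; split=> x /= => [[]|]].
by rewrite (_ : mkset _ = set0)//; apply/seteqP; split=> x /= => [[]|].
Qed.

End CountableOperations.

Section RealSublevels.
Context {d : measure_display} {T : measurableType d} {R : realType}.
Implicit Types (D : set T) (f g : T -> R).

Lemma measurable_lt D f g : measurable D ->
  measurable_fun D f -> measurable_fun D g ->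
  measurable (D `&` [set x | f x < g x]).
Proof.
move=> mD mf mg; rewrite (_ : _ `&` _ = D `\` (D `&` [set x | g x <= f x])).
  by apply: measurableD => //; exact: measurable_fun_le.
apply/seteqP; split=> x /= [Dx].
  by move=> fg; split=> // -[_]; rewrite leNgt fg.
by move=> /not_andP[//|/negP]; rewrite -ltNge.
Qed.

Lemma measurable_fun_ge D f : (forall c, measurable (D `&` [set x | c <= f x])) ->
  measurable_fun D f.
Proof.
move=> mf; apply: (measurability _ (RGenCInfty.measurableE R)) => //.
by move=> /= _ [_ [c ->] <-]; rewrite preimage_itvcy.
Qed.

Lemma measurable_fun_gt D f : (forall c, measurable (D `&` [set x | c < f x])) ->
  measurable_fun D f.
Proof.
move=> mf; apply: (measurability _ (RGenOInfty.measurableE R)) => //.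
by move=> /= _ [_ [c ->] <-]; rewrite preimage_itvoy.
Qed.

End RealSublevels.

(** A map into a topological space is Borel as soon as its preimages of the
    members of some countable network are measurable. *)
Lemma preimage_open_network {d} {T : measurableType d} {X : topologicalType}
    {I : countType} (B : I -> set X) (D : set T) (f : T -> X) (U : set X) :
  open U -> (forall x, U x -> exists2 i, B i x & B i `<=` U) ->
  (forall i, measurable (D `&` f @^-1` B i)) -> measurable (D `&` f @^-1` U).
Proof.
move=> oU BU mB.
rewrite (_ : _ `&` _ = [set x | exists i, B i `<=` U /\ (D `&` f @^-1` B i) x]).
  by apply: measurable_exists => i; apply: measurable_cond => _; exact: mB.
apply/seteqP; split=> x /=; last by move=> [i [iU [Dx Bx]]]; split=> //; exact: iU.
by move=> [Dx /BU[i Bx iU]]; exists i.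
Qed.

Lemma measurable_fun_borel {d} {T : measurableType d} {X : ptopologicalType}
    (D : set T) (f : T -> borelType X) :
  (forall U : set X, open U -> measurable (D `&` f @^-1` U)) ->
  measurable_fun D f.
Proof.
move=> mf; apply: (@measurability _ _ T (borelType X) D f (@open X)) => //.
by move=> _ [U oU <-]; exact: mf.
Qed.

Section RationalMatrices.
Context {R : realType} {p q : nat}.

Lemma rat_mx_dense (M : 'M[R]_(p, q)) (e : R) : 0 < e ->
  exists c : 'M[rat]_(p, q), `|M - map_mx ratr c| <= e.
Proof.
move=> e0; have /choice[c cP] : forall k : 'I_p * 'I_q, exists c : rat,
    `|M k.1 k.2 - ratr c| <= e.
  move=> k; have [|c] := @rat_in_itvoo R (M k.1 k.2 - e) (M k.1 k.2).
    by rewrite ltrBlDr ltrDl.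
  rewrite in_itv/= => /andP[c1 c2]; exists c.
  rewrite ger0_norm; last by rewrite subr_ge0 ltW.
  by rewrite ltW// ltrBlDr addrC -ltrBlDr.
exists (\matrix_(i, j) c (i, j)); apply: mx_norm_le (ltW e0) _ => i j.
by rewrite !mxE; exact: (cP (i, j)).
Qed.

Lemma measurable_mx_norm_le {d} {T : measurableType d} (D : set T)
    (f : T -> 'M[R]_(p, q)) (M : 'M[R]_(p, q)) (e : R) : 0 <= e ->
  measurable D -> (forall i j, measurable_fun D (fun x => f x i j)) ->
  measurable (D `&` [set x | `|f x - M| <= e]).
Proof.
move=> e0 mD mf; rewrite (_ : _ `&` _ = D `&` [set x |
    forall k : 'I_p * 'I_q, (D `&` [set x | `|f x k.1 k.2 - M k.1 k.2| <= e]) x]).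
  apply: measurableI => //; apply: measurable_forall => k.
  apply: measurable_fun_le => //; apply: measurableT_comp => //.
  by apply: measurable_funB => //; exact: measurable_cst.
apply/seteqP; split=> x [Dx fe]; split=> //.
  move=> k; split=> //=; rewrite (le_trans _ fe)//.
  by have := coord_le_mx_norm (f x - M) k.1 k.2; rewrite !mxE.
by apply: mx_norm_le => // i j; have [_] := fe (i, j); rewrite /= !mxE.
Qed.

End RationalMatrices.

(** * Rational times and uniform continuity *)

Section RationalTimes.
Context {R : realType}.

Lemma natSinv_lt (e : R) : 0 < e -> exists n : nat, n.+1%:R^-1 < e.
Proof.
move=> e0; have [n _ /(_ n (leqnn n)) ne] := near_infty_natSinv_lt (PosNum e0).
by exists n.
Qed.

(** The multiples [q t] of [t] with [q] a rational number of the unit interval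
    (rational numbers outside of it are clipped). *)
Definition rtime (t : R) (q : rat) : R := t * Num.min 1 (Num.max 0 (ratr q)).

Lemma rtime_in (t : R) q : 0 <= t -> rtime t q \in `[0, t].
Proof.
move=> t0; rewrite in_itv/= mulr_ge0 ?le_min ?ler01 ?le_max ?lexx//=.
by rewrite -[leRHS]mulr1 ler_wpM2l// ge_min lexx.
Qed.

Lemma rtime_dense (t s v : R) : 0 <= s -> s < v -> v <= t ->
  exists q, s < rtime t q < v.
Proof.
move=> s0 sv vt; have t0 : 0 < t by rewrite (le_lt_trans s0)// (lt_le_trans sv).
have [|q] := @rat_in_itvoo R (s / t) (v / t); first by rewrite ltr_pM2r ?invr_gt0.
rewrite in_itv/= => /andP[sq qv]; exists q.
have q0 : 0 <= ratr q :> R by rewrite (le_trans _ (ltW sq))// divr_ge0// ltW.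
have q1 : ratr q <= 1 :> R.
  by rewrite (le_trans (ltW qv))// ler_pdivrMr// mul1r.
rewrite /rtime (max_idPr q0) (min_idPr q1) mulrC.
by rewrite -ltr_pdivrMr// sq/= -ltr_pdivlMr.
Qed.

Lemma rtime_right (t v e : R) : v \in `[0, t] -> 0 < e ->
  exists q, v <= rtime t q < v + e.
Proof.
rewrite in_itv/= => /andP[v0]; rewrite le_eqVlt => /predU1P[->|vt] e0.
  exists 1; rewrite /rtime rmorph1 (max_idPr ler01) minxx mulr1 lexx/=.
  by rewrite ltrDl.
have [||q /andP[vq qe]] := @rtime_dense t v (Num.min t (v + e)) v0.
- by rewrite lt_min vt ltrDl.
- by rewrite ge_min lexx.
by exists q; rewrite (ltW vq)/=; move: qe; rewrite lt_min => /andP[].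
Qed.

End RationalTimes.

Section Heine.
Context {R : realType} {t : R} {p q : nat}.
Implicit Types f : R -> 'M[R]_(p, q).

(** Heine's theorem on [[0, t]] *)
Lemma within_unif_continuous f (e : R) : {within `[0, t], continuous f} ->
  0 < e -> exists2 c, 0 < c & forall v w, v \in `[0, t] -> w \in `[0, t] ->
    `|v - w| < c -> `|f v - f w| < e.
Proof.
move=> /subspace_continuousP cf e0; have e20 : 0 < e / 2 by rewrite divr_gt0.
have /compact_near_coveringP/near_covering_withinP cov := @segment_compact R 0 t.
pose P (c v : R) := forall w, w \in `[0, t] -> `|v - w| < c -> `|f v - f w| < e.
have [] := cov R (0^'+) P _; last first.
  move=> c /= c0 cP; exists (c / 2); first by rewrite divr_gt0.
  move=> v w vt wt vw; apply: (cP (c / 2)) => //=; last by rewrite divr_gt0.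
  by rewrite sub0r normrN gtr0_norm ?divr_gt0// ltr_pdivrMr// ltr_pMr// ltr1n.
move=> v vt; have /cvgrPdist_lt/(_ _ e20)[c /= c0 cP] := cf v vt.
have c20 : 0 < c / 2 by rewrite divr_gt0.
exists (ball v (c / 2), [set b | b < c / 2]).
  split; first by exists (c / 2).
  exists (c / 2) => // b /=; rewrite sub0r normrN => + b0.
  by rewrite gtr0_norm.
move=> [x b] /= [vx bc] xt w wt xw; rewrite [e]splitr.
have fx : `|f v - f x| < e / 2.
  apply: cP => //=; rewrite (lt_trans vx)//.
  by rewrite ltr_pdivrMr// ltr_pMr// ltr1n.
have fw : `|f v - f w| < e / 2.
  apply: cP => //=; rewrite [c]splitr (le_lt_trans _ (ltrD vx (lt_trans xw bc)))//.
  by rewrite (le_trans _ (ler_normD _ _))// addrA subrK.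
rewrite (le_lt_trans _ (ltrD fx fw))// (distrC (f v) (f x)).
by rewrite (le_trans _ (ler_normD _ _))// addrA subrK.
Qed.

Lemma within_le_rtime f (e : R) : {within `[0, t], continuous f} ->
  (forall r, `|f (rtime t r)| <= e) -> forall v, v \in `[0, t] -> `|f v| <= e.
Proof.
move=> cf fe v vt; apply/ler_addgt0Pr => c c0.
have [b b0 bP] := within_unif_continuous cf c0.
have [r /andP[vr rb]] := rtime_right vt b0.
have t0 : 0 <= t by move: vt; rewrite in_itv/= => /andP[/le_trans]; apply.
have := bP v (rtime t r) vt (rtime_in _ t0).
rewrite distrC ger0_norm ?subr_ge0// ltrBlDl => /(_ rb) /ltW frb.
rewrite (le_trans _ (lerD (fe r) frb))// [leRHS]addrC.
by rewrite (le_trans _ (ler_normD _ _))// subrK.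
Qed.

(** Approximation of a continuous path by step functions with rational values *)
Lemma within_step_approx f (e : R) : {within `[0, t], continuous f} ->
  0 < e -> exists (N : nat) (c : seq 'M[rat]_(p, q)), forall v, v \in `[0, t] ->
    `|f v - map_mx ratr (nth 0 c (Num.truncn (v * N%:R)))| <= e.
Proof.
move=> cf e0; have e20 : 0 < e / 2 by rewrite divr_gt0.
have [b b0 bP] := within_unif_continuous cf e20.
have [n nb] := natSinv_lt b0.
have /choice[c cP] : forall j : nat, exists c : 'M[rat]_(p, q),
    `|f (j%:R / n.+1%:R) - map_mx ratr c| <= e / 2.
  by move=> j; exact: rat_mx_dense.
(* the values of f at the times [j / (n + 1)] of [[0, t]], rounded *)
exists n.+1, (mkseq c (Num.truncn (t * n.+1%:R)).+1) => v vt.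
have /andP[v0 vt'] : 0 <= v <= t by move: vt; rewrite in_itv.
have n0 : 0 < n.+1%:R :> R by rewrite ltr0n.
have vn0 : 0 <= v * n.+1%:R by rewrite mulr_ge0.
rewrite nth_mkseq; last by rewrite ltnS le_truncn// ler_wpM2r.
set j := Num.truncn _; have /andP[jv vj] := truncn_itv vn0.
have jv' : j%:R / n.+1%:R <= v by rewrite ler_pdivrMr.
have : `|f v - f (j%:R / n.+1%:R)| < e / 2.
  apply: bP => //.
    by rewrite in_itv/= divr_ge0//= (le_trans jv').
  rewrite ger0_norm ?subr_ge0// (lt_trans _ nb)// ltrBlDr.
  rewrite -[X in X + _]mul1r -mulrDl ltr_pdivlMr//.
  by rewrite nat1r.
move=> /ltW fj; rewrite [e]splitr (le_trans _ (lerD fj (cP j)))//.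
by rewrite (le_trans _ (ler_normD _ _))// addrA subrK.
Qed.

End Heine.

(** The network consists of the closed uniform balls of radius [1/(n+1)] around
    the step functions [v |-> c_(floor (v N))], where [c] is a finite sequence of
    rational matrices; the balls are defined by their traces on rational times. *)
Lemma measurable_preimage_open_cpath {R : realType} {t : R} {p q : nat}
    {d} {T : measurableType d} (D : set T)
    (f : T -> cpath t p q) (U : set (cpath t p q)) : 0 <= t ->
  measurable D -> open U ->
  (forall u : R, u \in `[0, t] ->
     forall i j, measurable_fun D (fun x => f x u i j)) ->
  measurable (D `&` f @^-1` U).
Proof.
move=> t0 mD oU mf.
pose step N (c : seq 'M[rat]_(p, q)) (v : R) : 'M[R]_(p, q) :=
  map_mx ratr (nth 0 c (Num.truncn (v * N%:R))).
pose B (k : nat * seq 'M[rat]_(p, q) * nat) : set (cpath t p q) :=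
  [set y : cpath t p q | forall r,
    `|y (rtime t r) - step k.1.1 k.1.2 (rtime t r)| <= k.2.+1%:R^-1].
apply: (preimage_open_network (B := B)) => // [x Ux|[[N c] n]]; last first.
  rewrite (_ : _ `&` _ = D `&` [set x | forall r, (D `&`
      [set x | `|f x (rtime t r) - step N c (rtime t r)| <= n.+1%:R^-1]) x]).
    apply: measurableI => //; apply: measurable_forall => r.
    by apply: measurable_mx_norm_le => // i j; apply: mf; exact: rtime_in.
  apply/seteqP; split=> x [Dx fx]; split=> //.
    by move=> r; split=> //; exact: fx.
  by move=> r; have [] := fx r.
have /nbhs_cpathP[e e0 eU] : nbhs x U by exact: open_nbhs_nbhs.
have e40 : 0 < e / 2 / 2 by rewrite !divr_gt0.
have [n ne] := natSinv_lt e40.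
have n0 : 0 < n.+1%:R^-1 :> R by rewrite invr_gt0.
have [N [c cx]] := within_step_approx (@cpath_continuous _ _ _ _ x) n0.
exists (N, c, n); first by move=> r /=; apply: cx; exact: rtime_in.
move=> y /= yc; apply: eU => u ut.
have cxy : {within `[0, t], continuous (fun v => x v - y v)}.
  move=> v; apply: cvgB; exact: cpath_continuous.
apply: (@le_lt_trans _ _ (e / 2)); last first.
  by rewrite ltr_pdivrMr// ltr_pMr// ltr1n.
apply: (within_le_rtime cxy) => // r; rewrite [e / 2]splitr.
have := lerD (cx _ (rtime_in r t0)) (yc r).
move=> /le_trans -/(_ _ (lerD (ltW ne) (ltW ne))); apply: le_trans.
rewrite (distrC (y _)) (le_trans _ (ler_normD _ _))//.
by rewrite /step/= addrA subrK.
Qed.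

Lemma measurable_fun_cpath {R : realType} {t : R} {p q : nat}
    {d} {T : measurableType d} (D : set T) (f : T -> cpath t p q) : 0 <= t ->
  measurable D ->
  (forall u : R, u \in `[0, t] ->
     forall i j, measurable_fun D (fun x => f x u i j)) ->
  measurable_fun D (f : T -> borelType (cpath t p q)).
Proof.
move=> t0 mD mf; apply: measurable_fun_borel => U oU.
exact: measurable_preimage_open_cpath.
Qed.

(** * Right-continuous processes at random times *)

Section RightContinuity.
Context {R : realType}.

(** Right-continuity on [[0, u]] of a real function, in epsilon-delta form and
    for the restriction to [[0, u]]: nothing is required at the right of [u]. *)
Definition right_continuous_upto (u : R) (f : R -> R) : Prop :=
  forall s : R, s \in `[0, u] -> forall e : R, 0 < e ->
    exists2 c : R, 0 < c &
      forall v : R, s <= v < s + c -> v <= u -> `|f v - f s| < e.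

Lemma dpath_right_continuous {T : R} {p q : nat} (h : dpath T p q) (u : R) i j :
  u <= T -> right_continuous_upto u (fun s => h s i j).
Proof.
move=> uT s; rewrite in_itv/= => /andP[s0 su] e e0.
have [sT|Ts] := ltP s T.
  have s0T : 0 <= s < T by rewrite s0.
  have [c c0 cP] := cadlag_right (dpath_cadlag h) s0T e0.
  exists c => // v /cP vs _; rewrite (le_lt_trans _ vs)//.
  by have := coord_le_enorm (h v - h s) i j; rewrite !mxE.
exists 1 => // v /andP[sv _] vu; rewrite (_ : v = s) ?subrr ?normr0//.
by apply/eqP; rewrite eq_le sv andbT (le_trans vu)// (le_trans uT).
Qed.

Lemma cpath_right_continuous {T : R} {p q : nat} (x : cpath T p q) (u : R) i j :
  u <= T -> right_continuous_upto u (fun s => x s i j).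
Proof.
move=> uT s; rewrite in_itv/= => /andP[s0 su] e e0.
have [c c0 cP] := within_unif_continuous (@cpath_continuous _ _ _ _ x) e0.
exists c => // v /andP[sv vc] vu.
have := cP v s; rewrite !in_itv/= s0 (le_trans s0 sv) (le_trans vu uT).
rewrite (le_trans su uT) ger0_norm ?subr_ge0// ltrBlDl => /(_ isT isT vc).
apply: le_lt_trans.
by have := coord_le_mx_norm (x v - x s) i j; rewrite !mxE.
Qed.

End RightContinuity.

Section RandomTimes.
Context {R : realType} {d : measure_display} {Omega : measurableType d}.

(** A right-continuous process is measurable at a measurable random time: such
    a process is [>= c] at [sigma] iff, for all [k] and [l], it is
    [> c - 1/(k+1)] at some rational multiple of [u] that lies between [sigma]
    (included) and [sigma + 1/(l+1)]. *)
Lemma measurable_at_random_time (u : R) (f : Omega -> R -> R) (sigma : Omega -> R) :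
  0 <= u ->
  (forall s : R, s \in `[0, u] -> measurable_fun setT (fun w => f w s)) ->
  (forall w, right_continuous_upto u (f w)) ->
  (forall w, sigma w \in `[0, u]) ->
  measurable_fun setT sigma ->
  measurable_fun setT (fun w => f w (sigma w)).
Proof.
move=> u0 mf rf sigu ms; apply: measurable_fun_ge => c; rewrite setTI.
rewrite (_ : mkset _ = [set w | forall k l : nat, exists q : rat,
    (setT `&` [set w | sigma w <= rtime u q]) w /\
    ((setT `&` [set w | rtime u q < sigma w + l.+1%:R^-1]) w /\
    (setT `&` [set w | c - k.+1%:R^-1 < f w (rtime u q)]) w)]).
  apply: measurable_forall => k; apply: measurable_forall => l.
  apply: measurable_exists => q; apply: measurableI; last apply: measurableI.
  - exact: measurable_fun_le.
  - by apply: measurable_lt => //; exact: measurable_funD.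
  - by apply: measurable_lt => //; apply: mf; exact: rtime_in.
apply/seteqP; split=> w /= => [cf k l|cf].
  have k0 : 0 < k.+1%:R^-1 :> R by rewrite invr_gt0.
  have l0 : 0 < l.+1%:R^-1 :> R by rewrite invr_gt0.
  have [e e0 eP] := rf w _ (sigu w) _ k0.
  have el0 : 0 < Num.min e l.+1%:R^-1 by rewrite lt_min e0.
  have [q /andP[sq qe]] := rtime_right (sigu w) el0; exists q.
  have qu : rtime u q <= u by have := rtime_in q u0; rewrite in_itv => /andP[].
  have /andP[qe' ql] : (rtime u q < sigma w + e) &&
      (rtime u q < sigma w + l.+1%:R^-1).
    by move: qe; rewrite -ltrBlDl lt_min !ltrBlDl.
  split=> //; split=> //; split=> //=.
  have := eP (rtime u q) _ qu; rewrite sq qe' => /(_ isT).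
  rewrite ltr_distl => /andP[fs _].
  by rewrite (le_lt_trans _ fs)// lerD2r.
apply/ler_addgt0Pr => e e0; have e20 : 0 < e / 2 by rewrite divr_gt0.
have [k ke] := natSinv_lt e20.
have [b b0 bP] := rf w _ (sigu w) _ e20; have [l lb] := natSinv_lt b0.
have [q [[_ sq] [[_ /= ql] [_ /= cq]]]] := cf k l.
have qu : rtime u q <= u by have := rtime_in q u0; rewrite in_itv => /andP[].
have := bP (rtime u q) _ qu; rewrite sq/= (lt_trans ql) ?ltrD2l// => /(_ isT).
rewrite ltr_distl => /andP[_ qs].
move: (lt_trans cq qs); rewrite ltrBlDr => /ltW/le_trans; apply.
by rewrite -addrA lerD2l [leRHS]splitr lerD2l ltW.
Qed.
End RandomTimes.

(** * Crossing times and elementary sums *)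

Section CrossingTimes.
Context {R : realType}.

Lemma next_crossing_le (T : R) n p q (h : R -> 'M[R]_(p, q)) a v : a <= T ->
  exceed_times T n h a v -> next_crossing T n h a <= v.
Proof.
move=> aT Ev; have /andP[av vT] : a < v <= T by case: Ev.
have [an _ _] := next_crossingP n h aT; move: an; rewrite /next_crossing.
set i := ereal_inf _.
have iv : (i <= v%:E)%E by apply: ereal_inf_lbound; exists v.
have ai : (a%:E <= i)%E.
  by apply: le_ereal_inf_tmp => _ [s [/andP[/ltW as_ _] _] <-]; rewrite lee_fin.
have [iT _|Ti _] := leP i T%:E.
  rewrite -lee_fin fineK// fin_numE; apply/andP; split; apply/eqP => E.
    by move: ai; rewrite E.
  by move: iT; rewrite E.
by move: (lt_le_trans Ti iv); rewrite lte_fin ltNge vT.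
Qed.

(** Stopped at [u], the first passage after [a] happens before [c] iff it is
    witnessed at a rational time before [c]; by right-continuity of [h] the
    strict inequality in the definition of a crossing makes this possible. *)
Lemma next_crossing_ltP (T u c : R) n p q (h : dpath T p q) (a : R) :
  0 <= u <= T -> 0 <= a <= T ->
  Num.min u (next_crossing T n h a) < c <->
  u < c \/ exists r : rat, rtime u r < c /\ Num.min u a < rtime u r /\
    2 ^- n < enorm (h (rtime u r) - h (Num.min u a)).
Proof.
move=> /andP[u0 uT] /andP[a0 aT]; split; last first.
  move=> [uc|[r [rc [ar hr]]]]; first by rewrite gt_min uc.
  have ru : rtime u r <= u by have := rtime_in r u0; rewrite in_itv => /andP[].
  have au : Num.min u a = a.
    by apply/min_idPr; rewrite leNgt; apply/negP => ua; move: ar;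
      rewrite (min_idPl (ltW ua)) ltNge ru.
  rewrite au in ar hr; rewrite gt_min; apply/orP; right.
  apply: le_lt_trans rc; apply: next_crossing_le => //; split=> //.
  by rewrite ar (le_trans ru).
have [uc _|cu] := ltP u c; first by left.
rewrite gt_min ltNge cu/= => nc; right.
have [an nT] := next_crossingP n h aT.
have nT' : next_crossing T n h a < T by rewrite (lt_le_trans nc)// (le_trans cu).
have e0 : 0 < c - next_crossing T n h a by rewrite subr_gt0.
move=> /(_ nT' _ e0)[v [/andP[av vT] hv] /andP[_]]; rewrite subrKC => vc.
have vu : v < u by exact: lt_le_trans cu.
have v0 : 0 <= v by rewrite (le_trans a0)// ltW.
have au : Num.min u a = a by apply/min_idPr; rewrite ltW// (lt_trans av).
rewrite au; have v0T : 0 <= v < T by rewrite v0 (lt_le_trans vu).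
have b0 : 0 < enorm (h v - h a) - 2 ^- n by rewrite subr_gt0.
have [b bpos bP] := cadlag_right (dpath_cadlag h) v0T b0.
have m0 : 0 < Num.min b (c - v) by rewrite lt_min bpos subr_gt0.
have [|r /andP[vr rb]] := @rtime_right _ u v (Num.min b (c - v)) _ m0.
  by rewrite in_itv/= v0 ltW.
have /andP[rb' rc] : (rtime u r < v + b) && (rtime u r < c).
  by move: rb; rewrite -ltrBlDl lt_min ltrBlDl ltrD2r.
exists r; split=> //; split; first exact: lt_le_trans vr.
have hrv : enorm (h (rtime u r) - h v) < enorm (h v - h a) - 2 ^- n.
  by apply: bP; rewrite vr.
have tri : enorm (h v - h a) <=
    enorm (h (rtime u r) - h v) + enorm (h (rtime u r) - h a).
  rewrite -(enormN (_ - h v)) opprB (le_trans _ (ler_enormD _ _))//.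
  by rewrite addrA subrK.
by move: hrv; rewrite ltrBrDr -ltrBrDl => /lt_le_trans; apply; rewrite lerBlDl.
Qed.

(** The terms with [tau_k >= u] vanish, so that all times may be stopped at
    [u] without changing the sum. *)
Lemma elem_sum_stopped (T : R) n p q (h : R -> 'M[R]_(p, q)) :
  0 <= T -> cadlag T h ->
  exists K, forall N, (K <= N)%N -> forall (x : R -> 'cV[R]_q) u, u <= T ->
    elem_sum T n h x u = \sum_(k < N)
      h (Num.min u (crossing_time T n h k)) *m
        (x (Num.min u (crossing_time T n h k.+1)) -
         x (Num.min u (crossing_time T n h k))).
Proof.
move=> T0 ch; have [K KP] := crossing_time_eventually n T0 ch.
exists K => N KN x u uT; pose F k := h (crossing_time T n h k) *m
  (x (Num.min u (crossing_time T n h k.+1)) - x (Num.min u (crossing_time T n h k))).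
rewrite (_ : elem_sum _ _ _ _ _ = \sum_(k < N) F k); last first.
  rewrite /elem_sum (fsbig_ord _ _ F); apply/esym/fsbig_widen => // k [_ kN].
  have Kk : (K <= k)%N by rewrite (leq_trans KN)// leqNgt; apply/negP.
  by rewrite /preimage/= /F !KP ?(leqW Kk)// subrr mulmx0.
apply: eq_bigr => k _; rewrite /F.
have [uk|//] := leP u (crossing_time T n h k).
have := le_trans uk (crossing_time_le n h T0 k) => /min_idPl ->.
by rewrite subrr !mulmx0.
Qed.

End CrossingTimes.

Section Measurability.
Context {R : realType} {d : measure_display} {Omega : measurableType d}.

Lemma measurable_fun_enorm p q (D : set Omega) (f : Omega -> 'M[R]_(p, q)) :
  (forall i j, measurable_fun D (fun w => f w i j)) ->
  measurable_fun D (fun w => enorm (f w)).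
Proof.
move=> mf; apply: (@measurableT_comp _ _ _ _ _ _ (@Num.sqrt R)).
  by apply: nondecreasing_measurable => // a b; exact: ler_wsqrtr.
by apply: measurable_sum => i; apply: measurable_sum => j; exact: measurable_funX.
Qed.

Context {T : R} {m q : nat}.
(* A random pair of paths, observed up to time u *)
Variables (H : Omega -> dpath T m q) (X : Omega -> cpath T q 1) (u : R).
Hypotheses (u0 : 0 <= u) (uT : u <= T).
Hypothesis mH : forall s : R, s \in `[0, u] -> forall i j,
  measurable_fun setT (fun w => H w s i j).
Hypothesis mX : forall s : R, s \in `[0, u] -> forall i j,
  measurable_fun setT (fun w => X w s i j).

Let T0 : 0 <= T. Proof. exact: le_trans uT. Qed.

Let stopped n k w := Num.min u (crossing_time T n (H w) k).

Let stopped_in n k w : stopped n k w \in `[0, u].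
Proof.
rewrite in_itv/= le_min u0 ge_min lexx/= andbT.
by have /andP[] := crossing_time_itv n (H w) T0 k.
Qed.

Lemma measurable_fun_stopped_crossing n k :
  measurable_fun setT (fun w => Num.min u (crossing_time T n (H w) k)).
Proof.
elim: k => [|k mk]; first by rewrite /= ; exact: measurable_cst.
apply: measurable_fun_ge => c; rewrite setTI.
rewrite (_ : mkset _ = ~` ([set _ | u < c] `|` [set w | exists r : rat,
    rtime u r < c /\ (setT `&` [set w | stopped n k w < rtime u r]) w /\
    (setT `&` [set w | 2 ^- n <
      enorm (H w (rtime u r) - H w (stopped n k w))]) w])).
  apply/measurableC/measurableU.
    have [uc|uc] := boolP (u < c).
      by rewrite (_ : mkset _ = setT)//; apply/seteqP; split.
    by rewrite (_ : mkset _ = set0)//; apply/seteqP; split.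
  apply: measurable_exists => r; apply: measurable_cond => _.
  apply: measurableI; apply: measurable_lt => //.
  apply: measurable_fun_enorm => i j.
  rewrite (_ : (fun w => _) = (fun w => H w (rtime u r) i j) \-
    (fun w => H w (stopped n k w) i j)); last by apply/funext => w; rewrite !mxE.
  apply: measurable_funB; first by apply: mH; exact: rtime_in.
  apply: (measurable_at_random_time u0 (f := fun w s => H w s i j)) => //.
  - by move=> s su; exact: mH.
  - by move=> w; exact: dpath_right_continuous.
apply/seteqP; split=> w /=; rewrite leNgt.
  move=> /negP wc [uc|[r [rc [[_ kr] [_ hr]]]]]; apply: wc.
    by rewrite gt_min uc.
  apply/next_crossing_ltP; rewrite ?u0//; last by right; exists r.
  exact: crossing_time_itv.
move=> wc; apply/negP => /next_crossing_ltP; rewrite u0 uT.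
move=> /(_ isT (crossing_time_itv _ _ T0 _))[uc|[r [rc [kr hr]]]]; apply: wc.
  by left.
by right; exists r.
Qed.

Lemma measurable_fun_elem_sum n i j :
  measurable_fun setT (fun w => elem_sum T n (H w) (X w) u i j).
Proof.
have mHs k i' j' : measurable_fun setT (fun w => H w (stopped n k w) i' j').
  apply: (measurable_at_random_time u0 (f := fun w s => H w s i' j')) => //.
  - by move=> s su; exact: mH.
  - by move=> w; exact: dpath_right_continuous.
  - exact: measurable_fun_stopped_crossing.
have mXs k i' j' : measurable_fun setT (fun w => X w (stopped n k w) i' j').
  apply: (measurable_at_random_time u0 (f := fun w s => X w s i' j')) => //.
  - by move=> s su; exact: mX.
  - by move=> w; exact: cpath_right_continuous.
  - exact: measurable_fun_stopped_crossing.
apply: (@measurable_fun_cvg _ _ _ _ (fun N w => \sum_(k < N) \sum_l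
    H w (stopped n k w) i l *
      (X w (stopped n k.+1 w) l j - X w (stopped n k w) l j))).
  move=> N; apply: measurable_sum => k; apply: measurable_sum => l.
  by apply: measurable_funM => //; exact: measurable_funB.
move=> w _; have [K KP] := elem_sum_stopped n T0 (dpath_cadlag (H w)).
apply: cvg_near_cst; exists K => // N /= KN.
rewrite (KP N KN _ _ uT) summxE; apply: eq_bigr => k _.
by rewrite mxE; apply: eq_bigr => l _; rewrite !mxE.
Qed.

End Measurability.

(** * Evaluations are Borel for the path topologies *)

Section Evaluations.
Context {R : realType} {T : R} {p q : nat}.

Lemma J1_ballP (h g : dpath T p q) e : ball h e g ->
  exists2 l, time_change T l & forall u, u \in `[0, T] ->
    `|l u - u| < e /\ enorm (h u - g (l u)) < e.
Proof.
move=> /J1_distP[l tl]; rewrite /time_change_cost gt_max => /andP[le he].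
exists l => // u uT; split; rewrite -lte_fin.
  by apply: le_lt_trans le; apply: ereal_sup_ubound; exists u.
by apply: le_lt_trans he; apply: ereal_sup_ubound; exists u.
Qed.

Lemma time_change_end (l : R -> R) : 0 <= T -> time_change T l -> l T = T.
Proof.
move=> T0 tl; have [inc im _] := tl.
have TT : T \in `[0, T] by rewrite in_itv/= T0 lexx.
have [x xT lx] : (l @` `[0, T]) T by rewrite im.
have : l T <= T by have := time_change_in tl TT; rewrite in_itv => /andP[].
have : x <= T by move: xT; rewrite /= in_itv => /andP[].
rewrite le_eqVlt => /predU1P[xE _|xT' lT]; first by rewrite -{1}xE.
by have := inc _ _ xT TT xT'; rewrite lx ltNge lT.
Qed.

(** Time changes close to the identity keep a time of an open interval inside
    it, so that exceeding a level there is an open condition. *)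
Lemma open_dpath_exceeds (s v c : R) i j :
  open [set h : dpath T p q | exists2 u : R, u \in `[0, T] &
          s < u < v /\ c < h u i j].
Proof.
rewrite openE => h [u uT [/andP[su uv] cu]]; apply/nbhs_ballP.
(* [l u] stays in the open interval and [g (l u)] above [c] *)
pose e := Num.min (h u i j - c) (Num.min (u - s) (v - u)).
exists e => /=; first by rewrite !lt_min !subr_gt0 cu su.
move=> g /J1_ballP[l tl] /(_ u uT)[].
rewrite !lt_min => /andP[_ /andP[]]; rewrite !ltr_norml opprB => /andP[lu _].
move=> /andP[_ ul] /andP[hg _]; exists (l u); first exact: time_change_in.
split; first by rewrite -(ltrD2r (- u)) lu/= -(ltrD2r (- u)).
have := le_lt_trans (coord_le_enorm _ i j) hg; rewrite !mxE.
by rewrite ltr_norml => /andP[_]; rewrite ltrD2l ltrN2.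
Qed.

Lemma open_dpath_end (c : R) i j : 0 <= T ->
  open [set h : dpath T p q | c < h T i j].
Proof.
move=> T0; rewrite openE => h /= ch; apply/nbhs_ballP.
exists (h T i j - c); first by rewrite /= subr_gt0.
have TT : T \in `[0, T] by rewrite in_itv/= T0 lexx.
move=> g /J1_ballP[l tl] /(_ T TT)[_]; rewrite time_change_end// => hg /=.
have := le_lt_trans (coord_le_enorm _ i j) hg; rewrite !mxE.
by rewrite ltr_norml => /andP[_]; rewrite ltrD2l ltrN2.
Qed.

(** The value of a cadlag path at [s] is determined by the levels that it exceeds
    immediately after [s]. *)
Lemma dpath_ge_exceeds (h : dpath T p q) (s c : R) i j : 0 <= s < T ->
  c <= h s i j <-> forall k l : nat, exists2 u : R, u \in `[0, T] &
    s < u < s + l.+1%:R^-1 /\ c - k.+1%:R^-1 < h u i j.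
Proof.
move=> /andP[s0 sT]; have T0 := le_trans s0 (ltW sT).
have sT' : s \in `[0, T] by rewrite in_itv/= s0 ltW.
split=> [ch k l|ch].
  have k0 : 0 < k.+1%:R^-1 :> R by rewrite invr_gt0.
  have [b b0 bP] := dpath_right_continuous h i j (lexx T) sT' k0.
  have [||r /andP[sr rv]] :=
      @rtime_dense R T s (Num.min T (Num.min (s + b) (s + l.+1%:R^-1))) s0.
  - by rewrite !lt_min sT !ltrDl b0 invr_gt0/=.
  - by rewrite ge_min lexx.
  move: rv; rewrite !lt_min => /andP[rT /andP[rb rl]].
  exists (rtime T r); first exact: rtime_in.
  split; first by rewrite sr.
  have := bP (rtime T r); rewrite (ltW sr) rb (ltW rT) => /(_ isT isT).
  by rewrite ltr_distl => /andP[+ _]; apply: le_lt_trans; rewrite lerD2r.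
apply/ler_addgt0Pr => e e0; have e20 : 0 < e / 2 by rewrite divr_gt0.
have [k ke] := natSinv_lt e20.
have [b b0 bP] := dpath_right_continuous h i j (lexx T) sT' e20.
have [l lb] := natSinv_lt b0; have [u uT [/andP[su ul] cu]] := ch k l.
have uT' : u <= T by move: uT; rewrite in_itv => /andP[].
have := bP u _ uT'; rewrite (ltW su) (lt_trans ul) ?ltrD2l// => /(_ isT).
rewrite ltr_distl => /andP[_ us].
move: (lt_trans cu us); rewrite ltrBlDr => /ltW/le_trans; apply.
by rewrite -addrA lerD2l [leRHS]splitr lerD2l ltW.
Qed.

Lemma open_cpath_gt (s c : R) i j : s \in `[0, T] ->
  open [set x : cpath T p q | c < x s i j].
Proof.
move=> sT; rewrite openE => x /= cx; apply/nbhs_cpathP.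
exists (x s i j - c); first by rewrite subr_gt0.
move=> y /(_ s sT) xy /=.
have := le_lt_trans (coord_le_mx_norm _ i j) xy; rewrite !mxE.
by rewrite ltr_norml => /andP[_]; rewrite ltrD2l ltrN2.
Qed.

End Evaluations.

Section BorelEvaluations.
Context {R : realType} {T : R} {m d : nat}.
Local Notation E := (path_space T m d).

Lemma measurable_fst_open (U : set (dpath T m d)) : open U ->
  measurable ([set z | U z.1] : set (borelType E)).
Proof.
move=> oU; apply: sub_sigma_algebra.
by apply: (@open_comp _ _ (fst : E -> _) U) => // z _; exact: cvg_fst.
Qed.

Lemma measurable_snd_open (U : set (cpath T d 1)) : open U ->
  measurable ([set z | U z.2] : set (borelType E)).
Proof.
move=> oU; apply: sub_sigma_algebra.
by apply: (@open_comp _ _ (snd : E -> _) U) => // z _; exact: cvg_snd.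
Qed.

Lemma measurable_dpath_eval (s : R) i j : s \in `[0, T] ->
  measurable_fun setT (fun z : borelType E => z.1 s i j).
Proof.
rewrite in_itv/= => /andP[s0]; rewrite le_eqVlt => /predU1P[sT|sT].
  apply: measurable_fun_gt => c; rewrite setTI sT.
  apply: (@measurable_fst_open [set h : dpath T m d | c < h T i j]).
  by apply: open_dpath_end; rewrite -sT.
apply: measurable_fun_ge => c; rewrite setTI.
rewrite (_ : mkset _ = [set z : borelType E | forall k l : nat,
    exists2 u : R, u \in `[0, T] &
      s < u < s + l.+1%:R^-1 /\ c - k.+1%:R^-1 < z.1 u i j]).
  apply: measurable_forall => k; apply: measurable_forall => l.
  apply: (@measurable_fst_open [set h : dpath T m d | exists2 u : R,
    u \in `[0, T] & s < u < s + l.+1%:R^-1 /\ c - k.+1%:R^-1 < h u i j]).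
  exact: open_dpath_exceeds.
by apply/seteqP; split=> z /= /dpath_ge_exceeds; apply; rewrite s0.
Qed.

Lemma measurable_cpath_eval (s : R) i j : s \in `[0, T] ->
  measurable_fun setT (fun z : borelType E => z.2 s i j).
Proof.
move=> sT; apply: measurable_fun_gt => c; rewrite setTI.
apply: (@measurable_snd_open [set x : cpath T d 1 | c < x s i j]).
exact: open_cpath_gt.
Qed.

End BorelEvaluations.

(** * The raw filtration and causality *)

Section Filtration.
Context {R : realType} {T : R} {m d : nat}.
Local Notation E := (path_space T m d).

(** The events that generate the raw filtration at time [t]: those that depend
    on the value of one of the two paths at one time of [[0, t]]. *)
Definition evaluation_events (t : R) : set (set E) :=
  \bigcup_(s in `[0, t])
        (preimage_set_system setT (fun z : path_space T m d => z.1 s)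
           (<<s open >>) `|`
         preimage_set_system setT (fun z : path_space T m d => z.2 s)
           (<<s open >>)).

Local Notation F t := (g_sigma_algebraType (evaluation_events t)).

Lemma open_mx_gt p q (c : R) (i : 'I_p) (j : 'I_q) :
  open [set M : 'M[R]_(p, q) | c < M i j].
Proof.
apply: (@open_comp _ _ (fun M : 'M[R]_(p, q) => M i j) [set x | c < x]).
  by move=> M _; exact: coord_continuous.
exact: open_gt.
Qed.

Lemma filtration_dpath_eval (t s : R) i j : s \in `[0, t] ->
  measurable_fun setT (fun z : F t => z.1 s i j).
Proof.
move=> st; apply: measurable_fun_gt => c.
apply: sub_sigma_algebra; exists s => //; left.
exists [set M : 'M[R]_(m, d) | c < M i j] => //.
by apply: sub_sigma_algebra; exact: open_mx_gt.
Qed.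

Lemma filtration_cpath_eval (t s : R) i j : s \in `[0, t] ->
  measurable_fun setT (fun z : F t => z.2 s i j).
Proof.
move=> st; apply: measurable_fun_gt => c.
apply: sub_sigma_algebra; exists s => //; right.
exists [set M : 'M[R]_(d, 1) | c < M i j] => //.
by apply: sub_sigma_algebra; exact: open_mx_gt.
Qed.

(** The sets that do not separate [z] from [z'] form a sigma-algebra, and it
    contains the generators of the raw filtration. *)
Lemma filtration_causal (t : R) (A : set E) (z z' : E) : raw_filtration t A ->
  {in `[0, t], z.1 =1 z'.1} -> {in `[0, t], z.2 =1 z'.2} -> A z <-> A z'.
Proof.
move=> FA zz1 zz2; move: A FA; apply: smallest_sub.
  split=> [//|A zA|B zB].
    by split=> -[_ nA]; split=> //; apply: contra_not nA; rewrite zA.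
  by split=> -[n _ /zB Bn]; exists n.
move=> _ [s /= st [] [B _ <-]]; split=> -[_]; split=> //; move: b;
  by rewrite /= ?zz1 ?zz2.
Qed.

Lemma filtration_causal_fun (t : R) (f : E -> R) (z z' : E) :
  measurable_fun setT (f : F t -> R) ->
  {in `[0, t], z.1 =1 z'.1} -> {in `[0, t], z.2 =1 z'.2} -> f z = f z'.
Proof.
move=> mf zz1 zz2; apply/esym.
have := mf measurableT [set f z] (measurable_set1 _); rewrite setTI => fz.
by apply: (filtration_causal (A := f @^-1` [set f z]) fz zz1 zz2).1.
Qed.

End Filtration.

(** * The domain of convergence and the limit *)

Section Convergence.
Context {R : realType} {T : R} {m d : nat} {t : R} (tT : t <= T).
Local Notation E := (path_space T m d).
Implicit Types z : E.
Local Notation I n z := (cpath_restr tT (elem_integral n z)).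

Lemma restr_elem_integralE n z (u : R) : u \in `[0, t] ->
  I n z u = elem_sum T n z.1 z.2 u.
Proof.
move=> ut; rewrite cpath_ofE// cpath_ofE//.
by move: ut; rewrite !in_itv/= => /andP[-> /le_trans]; apply.
Qed.

Lemma conv_domP z : conv_dom m d tT z <-> forall e : R, 0 < e ->
  exists N, forall n r, (N <= n)%N -> (N <= r)%N -> forall u : R,
    u \in `[0, t] -> `|I n z u - I r z u| < e.
Proof. exact: cvg_cpath_cauchyP. Qed.

Lemma limit_integral_cvg z (u : R) : u \in `[0, t] -> conv_dom m d tT z ->
  elem_sum T n z.1 z.2 u @[n --> \oo] --> limit_integral tT z u.
Proof.
move=> ut zD; have := @cvg_cpath_eval _ _ _ _ _ (limit_integral tT z) u ut zD.
by under eq_fun do rewrite restr_elem_integralE//.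
Qed.

Lemma limit_integral_coord_cvg z (u : R) i j :
  u \in `[0, t] -> conv_dom m d tT z ->
  elem_sum T n z.1 z.2 u i j @[n --> \oo] --> limit_integral tT z u i j.
Proof.
move=> ut /(limit_integral_cvg ut) zD.
apply: (cvg_comp _ (fun M : 'M[R]_(m, 1) => M i j) zD).
exact: coord_continuous.
Qed.

Lemma continuous_restr_sub n r z :
  {within `[0, t], continuous (fun u => I n z u - I r z u)}.
Proof. by move=> u; apply: cvgB; exact: cpath_continuous. Qed.

(** By continuity the Cauchy condition need only be tested at rational times. *)
Lemma conv_dom_rtimeP z : 0 <= t ->
  conv_dom m d tT z <-> forall k, exists N, forall n r,
    (N <= n)%N -> (N <= r)%N -> forall a : rat,
      `|I n z (rtime t a) - I r z (rtime t a)| <= k.+1%:R^-1.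
Proof.
move=> t0; rewrite conv_domP; split=> [zc k|zc e e0].
  have [|N NP] := zc k.+1%:R^-1; first by rewrite invr_gt0.
  by exists N => n r Nn Nr a; apply/ltW/NP => //; exact: rtime_in.
have [k ke] := natSinv_lt e0; have [N NP] := zc k.
exists N => n r Nn Nr u ut; rewrite (le_lt_trans _ ke)//.
apply: (within_le_rtime (@continuous_restr_sub n r z)) => // a; exact: NP.
Qed.

Lemma conv_dom_supnormP z :
  conv_dom m d tT z <-> forall l, (1 <= l)%N -> exists2 N, (1 <= N)%N &
    forall n, (N <= n)%N -> forall r, (N <= r)%N ->
      (supnorm t (fun u => I n z u - I r z u)%R < (l%:R^-1)%:E)%E.
Proof.
rewrite conv_domP; split=> [zc l l1|zc e e0].
  have l0 : 0 < l%:R^-1 :> R by rewrite invr_gt0 ltr0n.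
  have l20 : 0 < l%:R^-1 / 2 :> R by rewrite divr_gt0.
  (* [m * 1] bounds the ratio of the Euclidean norm to the maximum norm; adding
     1 makes the denominator positive, and halving makes the bound strict. *)
  have c0 : 0 < (m * 1)%:R + 1 :> R by rewrite ltr_wpDl.
  have [N NP] := zc _ (divr_gt0 l20 c0); exists (maxn 1 N).
    by rewrite leq_max leqnn.
  move=> n; rewrite geq_max => /andP[_ Nn] r; rewrite geq_max => /andP[_ Nr].
  apply: (@le_lt_trans _ _ (l%:R^-1 / 2)%:E); last first.
    by rewrite lte_fin ltr_pdivrMr// ltr_pMr// ltr1n.
  apply: ge_ereal_sup => _ [u ut <-]; rewrite lee_fin.
  rewrite (le_trans (enorm_le_mx_norm _))//.
  have := ltW (NP n r Nn Nr u ut); rewrite ler_pdivlMr// mulrC.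
  by apply: le_trans; rewrite ler_wpM2r// lerDl.
have [k ke] := natSinv_lt e0; have [N _ NP] := zc k.+1 isT.
exists N => n r Nn Nr u ut; rewrite (le_lt_trans (mx_norm_le_enorm _))//.
rewrite -lte_fin; apply: (@le_lt_trans _ _
    (supnorm t (fun u => I n z u - I r z u))); last first.
  by rewrite (lt_trans (NP n Nn r Nr))// lte_fin.
by apply: ereal_sup_ubound; exists u.
Qed.

(** The domain of convergence is an event of every sigma-algebra that makes the
    evaluations up to time [t] measurable. *)
Lemma measurable_conv_dom {disp} {Omega : measurableType disp} (Z : Omega -> E) :
  0 <= t ->
  (forall s : R, s \in `[0, t] -> forall i j,
    measurable_fun setT (fun w => (Z w).1 s i j)) ->
  (forall s : R, s \in `[0, t] -> forall i j,
    measurable_fun setT (fun w => (Z w).2 s i j)) ->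
  measurable [set w | conv_dom m d tT (Z w)].
Proof.
move=> t0 mH mX.
have mI (u : R) n i j : u \in `[0, t] ->
    measurable_fun setT (fun w => I n (Z w) u i j).
  move=> ut; under eq_fun do rewrite restr_elem_integralE//.
  move: (ut); rewrite in_itv/= => /andP[u0 ut'].
  apply: (measurable_fun_elem_sum (H := fun w => (Z w).1)
    (X := fun w => (Z w).2)) => //.
  - exact: le_trans tT.
  - by move=> s; rewrite in_itv/= => /andP[s0 su] *; apply: mH;
      rewrite in_itv/= s0 (le_trans su).
  - by move=> s; rewrite in_itv/= => /andP[s0 su] *; apply: mX;
      rewrite in_itv/= s0 (le_trans su).
rewrite (_ : mkset _ = [set w | forall k : nat, exists N : nat, forall n r : nat,
    (N <= n)%N -> (N <= r)%N -> forall a : rat, (setT `&`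
      [set w | `|(I n (Z w) (rtime t a) - I r (Z w) (rtime t a)) - 0|
                 <= k.+1%:R^-1]) w]).
  apply: measurable_forall => k; apply: measurable_exists => N.
  apply: measurable_forall => n; apply: measurable_forall => r.
  apply: measurable_imply => _; apply: measurable_imply => _.
  apply: measurable_forall => a; apply: measurable_mx_norm_le => // i j.
  rewrite (_ : (fun w => _) = (fun w => I n (Z w) (rtime t a) i j) \-
    (fun w => I r (Z w) (rtime t a) i j)); last by apply/funext => w; rewrite !mxE.
  by apply: measurable_funB; apply: mI; exact: rtime_in.
apply/seteqP; split=> w /=; rewrite conv_dom_rtimeP// => wc k.
  have [N NP] := wc k; exists N => n r Nn Nr a; split=> //=.
  by rewrite subr0; exact: NP.
have [N NP] := wc k; exists N => n r Nn Nr a.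
by have [_] := NP n r Nn Nr a; rewrite /= subr0.
Qed.

End Convergence.

Lemma conv_dom_restr {R : realType} {T : R} {m d : nat} {s t : R} (st : s <= t)
    (tT : t <= T) :
  conv_dom m d tT `<=` conv_dom m d (le_trans st tT).
Proof.
move=> z /conv_domP zc; apply/conv_domP => e /zc[N NP].
exists N => n r Nn Nr u us.
have ut : u \in `[0, t].
  by move: us; rewrite !in_itv/= => /andP[-> /le_trans]; apply.
by have := NP n r Nn Nr u ut; rewrite !restr_elem_integralE.
Qed.

Section Borel.
Context {R : realType} {T : R} {m d : nat} {u : R}.
Hypotheses (u0 : 0 <= u) (uT : u <= T).
Local Notation E := (path_space T m d).

Let sub_itv (t s : R) : u <= t -> s \in `[0, u] -> s \in `[0, t].
Proof. by move=> ut; rewrite !in_itv/= => /andP[-> /le_trans]; apply. Qed.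

Lemma borel_elem_sum n i j :
  measurable_fun setT (fun z : borelType E => elem_sum T n z.1 z.2 u i j).
Proof.
apply: (measurable_fun_elem_sum (Omega := borelType E)
  (H := fun z : borelType E => z.1) (X := fun z : borelType E => z.2)) => //.
  by move=> s su i' j'; apply: measurable_dpath_eval; exact: sub_itv su.
by move=> s su i' j'; apply: measurable_cpath_eval; exact: sub_itv su.
Qed.

Lemma filtration_elem_sum (t : R) n i j : u <= t ->
  measurable_fun setT (fun z : g_sigma_algebraType (@evaluation_events R T m d t)
    => elem_sum T n z.1 z.2 u i j).
Proof.
move=> ut; apply: (measurable_fun_elem_sum
  (H := fun z : g_sigma_algebraType (@evaluation_events R T m d t) => z.1)
  (X := fun z : g_sigma_algebraType (@evaluation_events R T m d t) => z.2)) => //.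
  by move=> s su i' j'; apply: filtration_dpath_eval; exact: sub_itv su.
by move=> s su i' j'; apply: filtration_cpath_eval; exact: sub_itv su.
Qed.

End Borel.

Theorem theorem3p4 (R : realType) (T : R) (m d : nat)
    (T_gt0 : 0 < T) (m_ge1 : (1 <= m)%N) (d_ge1 : (1 <= d)%N)
    (t : R) (t_ge0 : 0 <= t) (tT : t <= T) :
  [/\ (* (i) *)
      forall n, (1 <= n)%N ->
        measurable_fun [set: borelType (path_space T m d)]
          (elem_integral n :
             borelType (path_space T m d) -> borelType (cpath T m 1)),
      (* (ii) *)
      [/\ raw_filtration t (conv_dom m d tT),
          measurable (conv_dom m d tT : set (borelType (path_space T m d))) &
          conv_dom m d tT =
          \bigcap_(l in [set l | (1 <= l)%N])
            \bigcup_(N in [set N | (1 <= N)%N])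
              \bigcap_(n in [set n | (N <= n)%N])
                \bigcap_(r in [set r | (N <= r)%N])
                  [set z : path_space T m d |
                    (supnorm t (fun u => (cpath_restr tT (elem_integral n z) u
                                  - cpath_restr tT (elem_integral r z) u)%R)
                     < (l%:R^-1)%:E)%E]],
      (* (iii) *)
      measurable_fun
        (conv_dom m d tT : set (borelType (path_space T m d)))
        (limit_integral tT :
           borelType (path_space T m d) -> borelType (cpath t m 1)),
      (* (iv) *)
      forall (s : R) (s_ge0 : 0 <= s) (st : s <= t),
        conv_dom m d tT `<=` conv_dom m d (le_trans st tT) /\
        (forall z, conv_dom m d tT z ->
          cpath_restr st (limit_integral tT z) =
          limit_integral (le_trans st tT) z) &
      (* (v) *)
      forall z z' : path_space T m d,
        {in `[0, t], z.1 =1 z'.1} -> {in `[0, t], z.2 =1 z'.2} ->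
        (conv_dom m d tT z <-> conv_dom m d tT z') /\
        (conv_dom m d tT z -> limit_integral tT z = limit_integral tT z')].
Proof.
have T0 := ltW T_gt0.
have lim_uniq (f : R^nat) (a b : R) :
    f n @[n --> \oo] --> a -> f n @[n --> \oo] --> b -> a = b.
  by move=> fa fb; exact: (cvg_unique (@Rhausdorff R) fa fb).
have convB : measurable (conv_dom m d tT : set (borelType (path_space T m d))).
  apply: (@measurable_conv_dom R T m d t tT _ (borelType (path_space T m d)) id)
    => // s st i j.
    apply: measurable_dpath_eval.
    by move: st; rewrite !in_itv/= => /andP[-> /le_trans]; apply.
  apply: measurable_cpath_eval.
  by move: st; rewrite !in_itv/= => /andP[-> /le_trans]; apply.
have convF : raw_filtration t (conv_dom m d tT).
  apply: (@measurable_conv_dom R T m d t tT _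
    (g_sigma_algebraType (@evaluation_events R T m d t)) id) => // s st i j.
    exact: filtration_dpath_eval.
  exact: filtration_cpath_eval.
split.
- move=> n _; apply: measurable_fun_cpath => // u uT i j.
  rewrite (_ : (fun z => _) = (fun z : borelType (path_space T m d) =>
      elem_sum T n z.1 z.2 u i j)).
    by move: uT; rewrite in_itv/= => /andP[u0 uT]; exact: borel_elem_sum.
  by apply/funext => z; rewrite cpath_ofE.
- split=> //; apply/seteqP; split=> z.
    move=> /conv_dom_supnormP zc l /= /zc[N N1 NP].
    by exists N => // n /= Nn r /= Nr; exact: NP.
  move=> zc; apply/conv_dom_supnormP => l /zc[N N1 NP].
  by exists N => // n Nn r Nr; exact: (NP n Nn r Nr).
- apply: measurable_fun_cpath => // u ut i j.
  apply: (@measurable_fun_cvg _ _ _ _ (fun n (z : borelType (path_space T m d)) =>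
    elem_sum T n z.1 z.2 u i j)).
    move=> n; apply: measurable_funTS.
    move: ut; rewrite in_itv/= => /andP[u0 ut].
    by apply: borel_elem_sum => //; exact: le_trans ut tT.
  by move=> z zD; exact: limit_integral_coord_cvg.
- move=> s s0 st; split; first exact: conv_dom_restr.
  move=> z zD; apply: cpath_ext => u us; rewrite cpath_ofE//.
  have ut : u \in `[0, t].
    by move: us; rewrite !in_itv/= => /andP[-> /le_trans]; apply.
  have zs := @conv_dom_restr _ _ _ _ _ _ st tT z zD.
  apply/matrixP => i j.
  apply: lim_uniq (limit_integral_coord_cvg ut zD) _.
  exact: (limit_integral_coord_cvg us zs).
move=> z z' zz1 zz2; have zz' := filtration_causal convF zz1 zz2.
split=> // zD; have zD' := zz'.1 zD.
apply: cpath_ext => u ut; apply/matrixP => i j.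
apply: lim_uniq (limit_integral_coord_cvg ut zD) _.
rewrite (_ : (fun n => _) = fun n => elem_sum T n z'.1 z'.2 u i j).
  exact: limit_integral_coord_cvg.
move: ut; rewrite in_itv/= => /andP[u0 ut].
apply/funext => n; apply: (filtration_causal_fun (t := t) (z := z) (z' := z')
  (f := fun z : path_space T m d => elem_sum T n z.1 z.2 u i j)) => //.
by apply: filtration_elem_sum => //; exact: le_trans ut tT.
Qed.
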